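(* Let $\mathcal T=\{T_1,\dots,T_m\}\subset\mathbb C^{d\times d}$ be a family of matrices that are all upper triangular or all lower triangular, with nonzero diagonal entries $(T_i)_{jj}=\lambda_j^{(i)}$, and with probability weights $p_1,\dots,p_m$. Let $\rho_\infty^{(j)}:=\prod_{i=1}^m|\lambda_j^{(i)}|^{p_i}$, $\rho_\infty:=\max_{1\le j\le d}\rho_\infty^{(j)}$, $\mu_\ell:=\log\rho_\infty^{(\ell)}=\sum_{i=1}^m p_i\log|\lambda_\ell^{(i)}|$, and let $J:=\arg\max_{1\le j\le d}\rho_\infty^{(j)}$ be the set of maximizing indices. Then $$\sqrt n\,\bigl(\rho_n(\mathcal T,\mathbb P_{\mathcal T})-\rho_\infty\bigr)\xRightarrow{d}\rho_\infty\cdot\max_{j\in J}G_j,$$ where $\boldsymbol G=(G_j)_{j\in J}$ is a zero-mean Gaussian vector with covariance matrix $\Sigma_{\mathcal T,\mathbb P_{\mathcal T}}=\{\Sigma(\ell,h)\}_{\ell,h\in J}$, $$\Sigma(\ell,h):=\sum_{i=1}^m p_i\log|\lambda_\ell^{(i)}|\,\log|\lambda_h^{(i)}|-\mu_\ell\mu_h .$$ Equivalently, for every continuity point $x$ of the limiting distribution, $$\lim_{n\to\infty}\mathbb P\bigl(\sqrt n(\rho_n-\rho_\infty)<x\bigr)=\mathbb P\Bigl(\max_{j\in J}G_j<\frac{x}{\rho_\infty}\Bigr).$$ If $\Sigma_{\mathcal T,\mathbb P_{\mathcal T}}$ is positive definite, then the limiting distribution has no atoms and the last equality holds for every $x\in\mathbb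 R$.
   Context: $\mathbb P_{\mathcal T}$ assigns mass $p_i\ge 0$ to $T_i$, with $\sum_i p_i=1$. Let $(i_k)_{k\ge1}$ be i.i.d. random indices in $\{1,\dots,m\}$ with $\mathbb P(i_k=i)=p_i$. The random spectral radius of length $n$ is $\rho_n=\rho_n(\mathcal T,\mathbb P_{\mathcal T}):=\rho(T_{i_n}\cdots T_{i_1})^{1/n}$, where $\rho(\cdot)$ is the spectral radius of a matrix. Gaussian vectors may be degenerate (covariance only positive semidefinite). *)

(* Defs.v *)
From HB Require Import structures.
From mathcomp Require Import all_boot all_order all_algebra complex.
From mathcomp Require Import finmap.
From mathcomp Require Import all_classical all_reals all_analysis.

Set Implicit Arguments.
Unset Strict Implicit.
Unset Printing Implicit Defensive.

Import Order.TTheory GRing.Theory Num.Theory.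
Import numFieldNormedType.Exports.
Local Open Scope classical_set_scope.
Local Open Scope ring_scope.
Local Open Scope complex_scope.

(* Modulus as an element of R; the norm `|z| of MathComp lives in R[i]. *)
Definition cmod (R : realType) (z : R[i]) : R := ComplexField.Normc.normc z.

(* A supremum, because the G_j may be negative and so no real number is a
   neutral default; it is a maximum on a nonempty I, see maxfP. *)
Definition maxf (R : realType) (I : finType) (g : I -> R) : R := sup (range g).

Lemma maxfP (R : realType) (I : finType) (g : I -> R) (i0 : I) :
  (exists i, g i = maxf g) /\ (forall i, g i <= maxf g).
Proof.
have [k _ kP] := @arg_maxP _ _ I i0 xpredT g isT.
have ub : ubound (range g) (g k) by move=> _ [i _ <-]; exact: kP.
have <- : g k = maxf g.
  apply/le_anti/andP; split.
    by apply: ub_le_sup; [exists (g k)|exists k].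
  by apply: ge_sup => //; exists (g k), k.
by split=> [|i]; [exists k|exact: kP].
Qed.

Definition spectral_radius (R : realType) (d : nat) (A : 'M[R[i]]_d) : R :=
  sup [set cmod z | z in [set z | eigenvalue A z]].

(* s is 0-based: mxprod T s n = T_(s (n-1)) ... T_(s 1) T_(s 0). *)
Fixpoint mxprod (R : realType) (m d : nat) (T : 'I_m -> 'M[R[i]]_d)
    (s : nat -> 'I_m) (n : nat) : 'M[R[i]]_d :=
  if n is k.+1 then T (s k) *m mxprod T s k else 1%:M.

Definition rho_n (R : realType) (m d : nat) (T : 'I_m -> 'M[R[i]]_d)
    (n : nat) (s : nat -> 'I_m) : R :=
  spectral_radius (mxprod T s n) `^ n%:R^-1.

Definition rho_inf_at (R : realType) (m d : nat) (T : 'I_m -> 'M[R[i]]_d)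
    (p : 'I_m -> R) (j : 'I_d) : R :=
  \prod_(i < m) cmod (T i j j) `^ p i.

Definition rho_inf (R : realType) (m d : nat) (T : 'I_m -> 'M[R[i]]_d)
    (p : 'I_m -> R) : R :=
  maxf (rho_inf_at T p).

Definition argmax (R : realType) (m d : nat) (T : 'I_m -> 'M[R[i]]_d)
    (p : 'I_m -> R) : finType :=
  {j : 'I_d | rho_inf_at T p j == rho_inf T p}.

Lemma argmax_inhabited (R : realType) (m d : nat) (T : 'I_m -> 'M[R[i]]_d)
    (p : 'I_m -> R) : (0 < d)%N -> inhabited (argmax T p).
Proof.
move=> d0; have [[j jE] _] := maxfP (rho_inf_at T p) (Ordinal d0).
by apply: inhabits; exists j; apply/eqP.
Qed.

Definition mu_log (R : realType) (m d : nat) (T : 'I_m -> 'M[R[i]]_d)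
    (p : 'I_m -> R) (l : 'I_d) : R :=
  ln (rho_inf_at T p l).

Lemma mu_logE (R : realType) (m d : nat) (T : 'I_m -> 'M[R[i]]_d)
    (p : 'I_m -> R) (l : 'I_d) :
  (forall i, T i l l != 0) ->
  mu_log T p l = \sum_(i < m) p i * ln (cmod (T i l l)).
Proof.
move=> T0; have c0 i : 0 < cmod (T i l l).
  rewrite lt_neqAle eq_sym; apply/andP; split.
    by apply: contra (T0 i) => /eqP /ComplexField.Normc.eq0_normc ->.
  by rewrite /cmod; case: (T i l l) => a b; exact: sqrtr_ge0.
rewrite /mu_log /rho_inf_at.
suff [] : 0 < \prod_(i < m) cmod (T i l l) `^ p i /\
  ln (\prod_(i < m) cmod (T i l l) `^ p i) =
  \sum_(i < m) p i * ln (cmod (T i l l)) by [].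
elim/big_ind2: _ => [|x y u v [x0 xE] [u0 uE]|i _].
- by rewrite ln1.
- by rewrite mulr_gt0// lnM ?posrE// xE uE.
- by rewrite powR_gt0// ln_powR.
Qed.

Definition Sigma (R : realType) (m d : nat) (T : 'I_m -> 'M[R[i]]_d)
    (p : 'I_m -> R) (l h : argmax T p) : R :=
  \sum_(i < m) p i * ln (cmod (T i (val l) (val l)))
                   * ln (cmod (T i (val h) (val h)))
  - mu_log T p (val l) * mu_log T p (val h).

Definition posdefinite (R : realType) (I : finType) (S : I -> I -> R) : Prop :=
  (forall l h, S l h = S h l) /\
  forall a : I -> R, (exists l, a l != 0) ->
    0 < \sum_(l : I) \sum_(h : I) a l * S l h * a h.

Definition iid_indices (R : realType) (m : nat) (p : 'I_m -> R)
    (dO : measure_display) (Omega : measurableType dO)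
    (P : probability Omega R) (idx : nat -> Omega -> 'I_m) : Prop :=
  [/\ forall k (A : set 'I_m), measurable (idx k @^-1` A),
      forall k i, P (idx k @^-1` [set i]) = (p i)%:E
    & forall (K : {fset nat}) (A : nat -> set 'I_m),
        P (\bigcap_(k in [set` K]) (idx k @^-1` A k)) =
        (\prod_(k <- K) P (idx k @^-1` A k))%E].

(* The library's normal_prob m 0 is the uniform law on [0, 1], so the
   degenerate normal law has to be given separately. *)
Definition normal_law (R : realType) (m s : R) (A : set R) : \bar R :=
  if s == 0 then \d_m A else normal_prob m s A.

(* Every linear combination of the components is normal, possibly constant. *)
Definition gaussian_vector (R : realType) (I : finType)
    (dG : measure_display) (Omega : measurableType dG)
    (P : probability Omega R) (G : I -> {RV P >-> R}) : Prop :=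
  forall a : I -> R, exists m s : R, 0 <= s /\
    forall A : set R, measurable A ->
      P ((fun w => \sum_(j : I) a j * G j w) @^-1` A) = normal_law m s A.

Definition centered_gaussian (R : realType) (I : finType)
    (S : I -> I -> R) (dG : measure_display) (Omega : measurableType dG)
    (P : probability Omega R) (G : I -> {RV P >-> R}) : Prop :=
  [/\ gaussian_vector G,
      forall j, 'E_P[G j]%E = 0%E
    & forall l h, covariance P (G l) (G h) = (S l h)%:E].

(* The variables may live on different probability spaces; test functions are
   bounded and continuous. *)
Definition cvg_in_distribution (R : realType)
    (dO : measure_display) (Omega : measurableType dO)
    (P : probability Omega R) (X : nat -> Omega -> R)
    (dY : measure_display) (OmegaY : measurableType dY)
    (Q : probability OmegaY R) (Y : OmegaY -> R) : Prop :=
  forall f : R -> R, continuous f -> (exists M : R, forall x, `|f x| <= M) ->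
    (fun n => 'E_P[f \o X n]%E) @ \oo --> 'E_Q[f \o Y]%E.

(* Main.v *)
(* A product of triangular matrices has spectral radius max_j prod |lambda_j|,
   so rho_n = exp (max_j S_n(j) / n) for random walks S_n(j) with steps
   log |lambda_j|.  Indices outside J are discarded by Chebyshev's inequality,
   and everything reduces to the convergence of P (W_n(j) < c for all j in J),
   where W_n(j) = (S_n(j) - n mu_j) / sqrt n.
   Averaging over one step contracts the supremum norm and maps
   x |-> cos (<a, x> + b) to exp (- v / n) times itself up to O(n^(-3/2)), with
   2 v = Var <a, step>; n iterations give E cos (<a, W_n> + b) -> E cos (<a, G> + b).
   Trigonometric polynomials form an algebra, and it contains products over J
   of (1 - y_j^N)^(2^N) with y_j = (1 + sin ((x_j - c) / K)) / 2, which sandwich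
   the indicator of {x_j < c for all j} up to a second-moment tail; this
   replaces the multivariate Levy continuity theorem. *)

Require Import Defs.
From HB Require Import structures.
From mathcomp Require Import all_boot all_order all_algebra complex.
From mathcomp Require Import finmap.
From mathcomp Require Import all_classical all_reals all_analysis.
From mathcomp Require Import measurable_realfun ring lra.

Set Implicit Arguments.
Unset Strict Implicit.
Unset Printing Implicit Defensive.

Import Order.TTheory GRing.Theory Num.Theory.
Import numFieldNormedType.Exports.
Local Open Scope classical_set_scope.
Local Open Scope ring_scope.
Local Open Scope complex_scope.

(** * The normal law *)

(** The covariance may be singular, so the law of the maximum may have atoms and the limit need not
    have a continuous distribution function. Every comparison with the limit is therefore a
    two-sided inequality of Levy type: the threshold is shifted by [eps] and an error [eta] is
    allowed. Such a bound survives the logarithm, the scaling by [rho_inf T p] and the removal of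
    the indices outside J, each of which spends part of the shift or of the error. It yields weak
    convergence as well as convergence of distribution functions at continuity points. For the walk
    nothing is integrated over [Omega]: the law of the first n indices is a finite weighted sum over
    words, and induction on n is conditioning on the first letter. For the Gaussian vector only the
    laws of linear combinations are given. They provide square integrability, which the tail bounds
    need, and the mean of a cosine. The latter comes from the normal density through one principle,
    that F' integrates to 0 when F decays fast enough. The phase b lets cosines stand for sines too,
    so no complex exponentials are needed. *)

Section integrable_real.
Context d (T : measurableType d) (R : realType) (mu : {measure set T -> \bar R}).
Implicit Types f g : T -> R.

Lemma integrable_addr f g : mu.-integrable setT (EFin \o f) ->
  mu.-integrable setT (EFin \o g) ->
  mu.-integrable setT (EFin \o (fun x => f x + g x)).
Proof. by move=> fi gi; exact: (integrableD measurableT fi gi). Qed.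

Lemma integrable_subr f g : mu.-integrable setT (EFin \o f) ->
  mu.-integrable setT (EFin \o g) ->
  mu.-integrable setT (EFin \o (fun x => f x - g x)).
Proof. by move=> fi gi; exact: (integrableB measurableT fi gi). Qed.

Lemma integrable_mulrl (c : R) f : mu.-integrable setT (EFin \o f) ->
  mu.-integrable setT (EFin \o (fun x => c * f x)).
Proof. by move=> fi; exact: (integrableZl measurableT c fi). Qed.

End integrable_real.

Lemma measurable_fun_lt d (T : measurableType d) (R : realType) (f : T -> R) (x : R) :
  measurable_fun setT f -> measurable [set w | f w < x].
Proof.
move=> mf; rewrite -[X in measurable X]setTI; apply: (mf measurableT [set y | y < x]).
have -> : [set y : R | y < x] = `]-oo, x[%classic by apply/seteqP; split=> y;
    rewrite /= in_itv.
exact: measurable_itv.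
Qed.

Section normal.
Context {R : realType}.
Local Notation mu := (@lebesgue_measure R).

(** The fundamental theorem of calculus on segments of radius n + 1 around [c] leaves only boundary
    values of [F], which the last hypothesis bounds by K / (n + 1); dominated convergence does the
    rest. The moments and the Stein identity below are instances, with [F] built from the
    density. *)
Lemma integral_derivative_eq0 (F f : R -> R) (c K : R) :
  (forall x : R, is_derive x (1 : R) F (f x)) -> continuous f ->
  mu.-integrable setT (EFin \o f) ->
  (forall x, `|x - c| * `|F x| <= K) ->
  \int[mu]_x f x = 0.
Proof.
move=> dF cf intf FK.
pose I (n : nat) : set R := [set` `[c - n.+1%:R, c + n.+1%:R]].
have I_int n : (\int[mu]_x ((f \_ (I n)) x)%:E =
    (F (c + n.+1%:R) - F (c - n.+1%:R))%:E)%E.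
  transitivity (\int[mu]_(x in I n) (f x)%:E)%E.
    by rewrite [RHS]integral_mkcond; apply: eq_integral => x _; rewrite restrict_EFin.
  rewrite (@continuous_FTC2 _ f F).
  - by rewrite EFinB.
  - by rewrite ltrD2l gt0_cp// ltr0n.
  - exact: continuous_subspaceT.
  - have cF : continuous F.
      by move=> x; apply/differentiable_continuous/derivable1_diffP; case: (dF x).
    split.
    + by move=> x _; case: (dF x).
    + by apply: cvg_at_right_filter; exact: cF.
    + by apply: cvg_at_left_filter; exact: cF.
  - by move=> x _; rewrite derive1E; case: (dF x).
have mf : measurable_fun setT f by apply/measurable_EFinP; exact: measurable_int intf.
have [|||||_ _ /= lim1] := @dominated_convergence _ _ _ mu setT measurableT
  (fun n => EFin \o (f \_ (I n))) (EFin \o f) (abse \o (EFin \o f)).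
- move=> n; apply/measurable_EFinP/(measurable_restrictT _ _).1.
    exact: measurable_itv.
  exact: measurable_funTS.
- exact/measurable_EFinP.
- apply: aeW => x _; apply: cvg_near_cst; near=> n.
  rewrite /= patchE ifT// inE /I /= in_itv/= -ler_distlC.
  apply: (@le_trans _ _ n%:R); last by rewrite ler_nat.
  by near: n; exact: nbhs_infty_ger.
- exact: (integrable_abse intf).
- apply: aeW => x n _ /=; rewrite lee_fin patchE; case: ifP => //.
  by rewrite normr0.
have lim2 : (fun n => (F (c + n.+1%:R) - F (c - n.+1%:R))%:E) @ \oo --> 0%:E.
  apply/cvg_EFin; first exact: nearW.
  rewrite /comp/=; apply/cvgrPdist_le => e e0; near=> n.
  rewrite sub0r normrN (le_trans (ler_normB _ _))//.
  have bnd y : `|y - c| = n.+1%:R -> `|F y| <= e / 2.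
    move=> yE; have := FK y; rewrite yE -ler_pdivlMl ?ltr0n// => /le_trans; apply.
    rewrite ler_pdivrMl ?ltr0n// -ler_pdivrMr ?divr_gt0//.
    apply: (@le_trans _ _ n%:R); last by rewrite ler_nat.
    by near: n; exact: nbhs_infty_ger.
  rewrite (splitr e) lerD// bnd// ?(addrC c) ?addrK ?opprK.
    by rewrite ger0_norm.
  by rewrite normrN ger0_norm.
have lim1' : (fun n => (F (c +
    n.+1%:R) - F (c - n.+1%:R))%:E) @ \oo --> (\int[mu]_x (f x)%:E)%E.
  rewrite (_ : (fun n => _) = (fun n => (\int[mu]_x ((f \_ (I n)) x)%:E)%E))//.
  by apply/funext => n; rewrite I_int.
by rewrite /Rintegral (cvg_unique _ lim1' lim2).
Unshelve. all: by end_near. Qed.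

Variables m s : R.
Hypothesis s0 : s != 0.
Local Notation pdf := (normal_pdf m s).

Lemma normal_pdf_expR x : pdf x = normal_peak s * expR (- (x - m) ^+ 2 / (s ^+ 2 *+ 2)).
Proof. by rewrite normal_pdfE. Qed.

Lemma is_derive_normal_pdf (x : R) :
  is_derive x (1 : R) pdf (- (x - m) / s ^+ 2 * pdf x).
Proof.
have -> : pdf = (fun x => normal_peak s * expR (- (x - m) ^+ 2 / (s ^+ 2 *+ 2))).
  by apply/funext => y; rewrite normal_pdf_expR.
have dg : is_derive x (1 : R) (fun x : R =>
    - (x - m) ^+ 2 / (s ^+ 2 *+ 2)) (- (x - m) / s ^+ 2).
  apply: is_derive_eq.
  rewrite /GRing.scale/=.
  by field.
have de := @is_derive1_comp _ expR _ x _ _ (is_derive_expR _) dg.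
apply: is_derive_eq.
rewrite /GRing.scale/=; ring.
Qed.

(** This is [1 + u <= expR u] at u = (x - m)^2 / (2 s^2). It supplies the decay constants [K] that
    [integral_derivative_eq0] asks for. *)
Lemma sqr_normal_pdf_le x : (x - m) ^+ 2 * pdf x <= 2 * s ^+ 2 * normal_peak s.
Proof.
rewrite normal_pdf_expR mulrCA mulrC ler_wpM2r ?normal_peak_ge0//.
set y := (x - m) ^+ 2; have s20 : 0 < s ^+ 2 by rewrite exprn_even_gt0.
have y0 : 0 <= y by exact: sqr_ge0.
rewrite mulNr expRN ler_pdivrMr ?expR_gt0//.
apply: (@le_trans _ _ (2 * s ^+ 2 * (1 + y / (s ^+ 2 *+ 2)))); last first.
  by rewrite ler_wpM2l ?expR_ge1Dx// mulr_ge0// ltW.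
have -> : 2 * s ^+ 2 * (1 + y / (s ^+ 2 *+ 2)) = 2 * s ^+ 2 + y by field.
by rewrite lerDr mulr_ge0// ltW.
Qed.

(** Half of the exponent absorbs the quadratic factor, by [1 + u <= expR u] at u = (x - m)^2 / (4
    s^2); the other half is a multiple of the normal density of variance 2 s^2. *)
Lemma integrable_sqr_normal_pdf :
  mu.-integrable setT (fun x => ((x - m) ^+ 2 * pdf x)%:E).
Proof.
pose s' := Num.sqrt 2 * s.
have s'0 : s' != 0 by rewrite mulf_neq0// sqrtr_eq0 -ltNge.
have s'2 : s' ^+ 2 = 2 * s ^+ 2 by rewrite exprMn sqr_sqrtr.
pose C := 4 * s ^+ 2 * normal_peak s / normal_peak s'.
apply: (@le_integrable _ _ _ mu setT measurableT _ (fun x =>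
    (C * normal_pdf m s' x)%:E)).
- apply/measurable_EFinP/measurable_funM; last exact: measurable_normal_pdf.
  by apply: measurable_funX; exact: measurable_funB.
- move=> x _; rewrite /= lee_fin.
  have C0 : 0 <= C by rewrite divr_ge0 ?normal_peak_ge0// mulr_ge0
      ?normal_peak_ge0// mulr_ge0// sqr_ge0.
  rewrite !ger0_norm; last 2 first.
  - by rewrite mulr_ge0// normal_pdf_ge0.
  - by rewrite mulr_ge0 ?sqr_ge0// normal_pdf_ge0.
  rewrite normal_pdf_expR (normal_pdfE _ s'0)/= /normal_fun s'2 /C.
  rewrite [leRHS]mulrA divfK ?gt_eqF ?normal_peak_gt0//.
  set y := (x - m) ^+ 2; have y0 : 0 <= y by exact: sqr_ge0.
  have s20 : 0 < s ^+ 2 by rewrite exprn_even_gt0.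
  have -> : - y / (s ^+ 2 *+ 2) =
      - y / ((2 * s ^+ 2) *+ 2) + - y / ((2 * s ^+ 2) *+ 2) by field.
  rewrite expRD mulrCA [leRHS]mulrAC [in leRHS]mulrC ler_wpM2l ?normal_peak_ge0//.
  rewrite mulrA ler_wpM2r ?expR_ge0//.
  rewrite mulNr expRN ler_pdivrMr ?expR_gt0//.
  apply: (@le_trans _ _ (4 * s ^+ 2 * (1 + y / ((2 * s ^+ 2) *+ 2)))); last first.
    by rewrite ler_wpM2l ?expR_ge1Dx// mulr_ge0// ltW.
  have -> : 4 * s ^+ 2 * (1 + y / ((2 * s ^+ 2) *+ 2)) = 4 * s ^+ 2 + y by field.
  by rewrite lerDr mulr_ge0// ltW.
- under eq_fun do rewrite EFinM.
  by apply: integrableZl => //; exact: integrable_normal_pdf.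
Qed.

Lemma le_integrableR (f g : R -> R) : continuous f ->
  mu.-integrable setT (EFin \o g) -> (forall x, `|f x| <= g x) ->
  mu.-integrable setT (EFin \o f).
Proof.
move=> cf ig fg; apply: (le_integrable _ _ _ ig) => //.
  apply/measurable_EFinP.
  apply: open_continuous_measurable_fun; first exact: openT.
  by move=> x _; exact: cf.
by move=> x _ /=; rewrite lee_fin (le_trans (fg x))//; exact: ler_norm.
Qed.

Lemma integrable_quadratic_normal_pdf (c1 c2 : R) :
  mu.-integrable setT (fun x => ((c1 + c2 * (x - m) ^+ 2) * pdf x)%:E).
Proof.
have -> : (fun x => ((c1 + c2 * (x - m) ^+ 2) * pdf x)%:E) =
    (fun x => c1%:E * (pdf x)%:E + c2%:E * ((x - m) ^+ 2 * pdf x)%:E)%E.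
  by apply/funext => x; rewrite mulrDl -mulrA EFinD !EFinM.
apply: integrableD => //; apply: integrableZl => //.
- exact: integrable_normal_pdf.
- exact: integrable_sqr_normal_pdf.
Qed.

Lemma normr_le_1Dsqr (u : R) : `|u| <= 1 + u ^+ 2.
Proof.
rewrite -(real_normK (num_real u)); set v := `|u|.
rewrite -subr_ge0 (_ : _ - _ = (v - 2^-1) ^+ 2 + 3 / 4); last by field.
by rewrite addr_ge0 ?sqr_ge0.
Qed.

Lemma quadratic_normal_pdf_le x : (1 + (x - m) ^+ 2) * pdf x <=
    normal_peak s + 2 * s ^+ 2 * normal_peak s.
Proof. by rewrite mulrDl mul1r lerD ?normal_pdf_ub ?sqr_normal_pdf_le. Qed.

Let diff_continuous (f : R -> R) : (forall x : R, derivable f x 1) -> continuous f.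
Proof. by move=> df x; apply/differentiable_continuous/derivable1_diffP. Qed.

(** The primitive is the density itself, up to the factor - s^2. *)
Lemma mean_normal_pdf : \int[mu]_x ((x - m) * pdf x) = 0.
Proof.
have cf : continuous (fun x : R => - (x - m) / s ^+ 2 * pdf x).
  apply: diff_continuous => x; have := is_derive_normal_pdf x => dp.
  exact: ex_derive.
have intf : mu.-integrable setT (fun x => (- (x - m) / s ^+ 2 * pdf x)%:E).
  apply: (le_integrableR _ (integrable_quadratic_normal_pdf (s ^- 2) (s ^- 2))) => // x.
  rewrite normrM (ger0_norm (normal_pdf_ge0 _ _ _)) ler_wpM2r ?normal_pdf_ge0//.
  rewrite normrM normrN [X in _ * X]ger0_norm ?invr_ge0 ?sqr_ge0//.
  by rewrite mulrC -[X in _ <=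
      X + _]mulr1 -mulrDr ler_wpM2l ?invr_ge0 ?sqr_ge0// normr_le_1Dsqr.
have := integral_derivative_eq0 (c := m) (K := normal_peak s +
    2 * s ^+ 2 * normal_peak s) is_derive_normal_pdf cf intf.
have pE x : (x - m) * pdf x = - s ^+ 2 * (- (x - m) / s ^+ 2 * pdf x) by field.
under [in X in _ -> X]eq_Rintegral do rewrite pE.
rewrite RintegralZl// => -> => [|x]; first by rewrite mulr0.
apply: le_trans (quadratic_normal_pdf_le x).
by rewrite (ger0_norm (normal_pdf_ge0 _ _ _)) ler_wpM2r ?normal_pdf_ge0//
    normr_le_1Dsqr.
Qed.

(** The primitive (x - m) pdf has derivative pdf - (x - m)^2 / s^2 pdf, whose integral vanishes, and
    the density integrates to 1. *)
Lemma variance_normal_pdf : \int[mu]_x ((x - m) ^+ 2 * pdf x) = s ^+ 2.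
Proof.
pose f x := pdf x + (x - m) * (- (x - m) / s ^+ 2 * pdf x).
have df (x : R) : is_derive x (1 : R) (fun x => (x - m) * pdf x) (f x).
  have := is_derive_normal_pdf x => dp.
  by apply: is_derive_eq; rewrite /GRing.scale/= /f; ring.
have cf : continuous f.
  apply: diff_continuous => x; have := is_derive_normal_pdf x => dp.
  exact: ex_derive.
have intf : mu.-integrable setT (EFin \o f).
  apply: (le_integrableR _ (integrable_quadratic_normal_pdf 1 (s ^- 2))) => // x.
  have -> : f x = (1 - s ^- 2 * (x - m) ^+ 2) * pdf x by rewrite /f; field.
  rewrite normrM (ger0_norm (normal_pdf_ge0 _ _ _)) ler_wpM2r ?normal_pdf_ge0//.
  rewrite (le_trans (ler_normB _ _))// normr1 ger0_norm//.
  by rewrite mulr_ge0 ?invr_ge0 ?sqr_ge0.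
have := integral_derivative_eq0 (c := m) (K := 2 * s ^+ 2 * normal_peak s) df cf intf.
have pE x : (x - m) ^+ 2 * pdf x = s ^+ 2 * (pdf x - f x) by rewrite /f; field.
under [in X in _ -> X]eq_Rintegral do rewrite pE.
have ip : mu.-integrable setT (EFin \o pdf) by exact: integrable_normal_pdf.
rewrite RintegralZl//; last first.
  exact: integrable_subr.
rewrite RintegralB// => -> => [|x].
  by rewrite /Rintegral integral_normal_pdf subr0 mulr1.
rewrite normrM mulrA -expr2 real_normK ?num_real//.
by rewrite (ger0_norm (normal_pdf_ge0 _ _ _)) sqr_normal_pdf_le.
Qed.

Let is_derive_affine (c t b x : R) : is_derive x (1 : R) (fun x => t * (x - c) + b) t.
Proof. by apply: is_derive_eq; rewrite /GRing.scale/=; ring. Qed.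

Let is_derive_sin_affine (c t b x : R) :
  is_derive x (1 : R) (fun x => sin (t * (x - c) + b)) (t * cos (t * (x - c) + b)).
Proof.
have := @is_derive1_comp _ (@sin R) _ x _ _ (is_derive_sin _) (is_derive_affine c t
    b x).
by move=> d; apply: is_derive_eq; rewrite /GRing.scale/=; ring.
Qed.

Let is_derive_cos_affine (c t b x : R) :
  is_derive x (1 : R) (fun x => cos (t * (x - c) + b)) (- (t * sin (t * (x - c) + b))).
Proof.
have := @is_derive1_comp _ (@cos R) _ x _ _ (is_derive_cos _) (is_derive_affine c t
    b x).
by move=> d; apply: is_derive_eq; rewrite /GRing.scale/=; ring.
Qed.

Lemma integrable_cos_normal_pdf (t b : R) :
  mu.-integrable setT (fun x => (cos (t * (x - m) + b) * pdf x)%:E).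
Proof.
apply: (le_integrableR _ (integrable_quadratic_normal_pdf 1 0)) => [|x].
  apply: diff_continuous => x; have dp := is_derive_normal_pdf x.
  have dc := is_derive_cos_affine m t b x.
  exact: ex_derive.
rewrite normrM (ger0_norm (normal_pdf_ge0 _ _ _)) ler_wpM2r ?normal_pdf_ge0//.
by rewrite mul0r addr0 cos_max.
Qed.

(** Stein's identity, that is Gaussian integration by parts, with sin (t (x - m) + b) times the
    density as primitive. The left side is the derivative in [t] of the cosine integral, so this is
    the differential equation behind [cos_normal_pdf]. *)
Lemma stein_normal_pdf (t b : R) :
  \int[mu]_x (- ((x - m) * sin (t * (x - m) + b)) * pdf x) =
  - (s ^+ 2 * t) * \int[mu]_x (cos (t * (x - m) + b) * pdf x).
Proof.
pose f x := t * cos (t * (x - m) + b) * pdf x +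
  sin (t * (x - m) + b) * (- (x - m) / s ^+ 2 * pdf x).
have df (x : R) : is_derive x (1 : R) (fun x => sin (t * (x - m) + b) * pdf x) (f x).
  have dp := is_derive_normal_pdf x; have ds := is_derive_sin_affine m t b x.
  by apply: is_derive_eq; rewrite /GRing.scale/= /f; ring.
have cf : continuous f.
  apply: diff_continuous => x; have dp := is_derive_normal_pdf x.
  have ds := is_derive_sin_affine m t b x; have dc := is_derive_cos_affine m t b x.
  exact: ex_derive.
have intcos := integrable_cos_normal_pdf t b.
have intf : mu.-integrable setT (EFin \o f).
  apply: (le_integrableR _ (integrable_quadratic_normal_pdf (`|t| +
      s ^- 2) (s ^- 2))) => // x.
  have -> : f x = (t * cos (t * (x - m) +
      b) - s ^- 2 * ((x - m) * sin (t * (x - m) + b))) * pdf x.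
    by rewrite /f; field.
  rewrite normrM (ger0_norm (normal_pdf_ge0 _ _ _)) ler_wpM2r ?normal_pdf_ge0//.
  rewrite (le_trans (ler_normB _ _))// -addrA lerD//.
    by rewrite normrM ler_piMr// cos_max.
  rewrite normrM ger0_norm ?invr_ge0 ?sqr_ge0// -[X in _ <= X + _]mulr1 -mulrDr.
  rewrite ler_wpM2l ?invr_ge0 ?sqr_ge0// normrM (le_trans _ (normr_le_1Dsqr _))//.
  by rewrite ler_piMr// sin_max.
have := integral_derivative_eq0 (c := m) (K := normal_peak s +
    2 * s ^+ 2 * normal_peak s) df cf intf.
have pE x : - ((x - m) * sin (t * (x - m) + b)) * pdf x =
   s ^+ 2 * (f x - t * (cos (t * (x - m) + b) * pdf x)) by rewrite /f; field.
under [in X in _ -> X]eq_Rintegral do rewrite pE.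
have intcos' : mu.-integrable setT (fun x => (t * (cos (t * (x - m) + b) * pdf x))%:E).
  exact: integrable_mulrl.
rewrite RintegralZl//; last first.
  exact: integrable_subr.
rewrite RintegralB// RintegralZl// => -> => [|x]; first by ring.
apply: le_trans (quadratic_normal_pdf_le x).
rewrite normrM (ger0_norm (normal_pdf_ge0 _ _ _)) mulrA ler_wpM2r ?normal_pdf_ge0//.
by rewrite (le_trans _ (normr_le_1Dsqr _))// ler_piMr// sin_max.
Qed.

(** As a function of t the left side solves phi' = - s^2 t phi, by differentiation under the
    integral and Stein's identity. Hence phi(t) exp (s^2 t^2 / 2) is constant, with value cos b at t
    = 0. *)
Lemma cos_normal_pdf (t b : R) :
  \int[mu]_x (cos (t * (x - m) + b) * pdf x) = cos b * expR (- (s ^+ 2 * t ^+ 2 / 2)).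
Proof.
pose phi (t : R) := \int[mu]_x (cos (t * (x - m) + b) * pdf x).
have intcos := integrable_cos_normal_pdf ^~ b.
have dx (u x : R) : is_derive u (1 : R) (fun u => cos (u * (x - m) + b) * pdf x)
    (- ((x - m) * sin (u * (x - m) + b)) * pdf x).
  have d1 : is_derive u (1 : R) (fun u => u * (x - m) + b) (x - m).
    by apply: is_derive_eq; rewrite /GRing.scale/=; ring.
  have d2 := @is_derive1_comp _ (@cos R) _ u _ _ (is_derive_cos _) d1.
  by apply: is_derive_eq; rewrite /GRing.scale/=; ring.
have dphi (u : R) : is_derive u (1 : R) phi (- (s ^+ 2 * u) * phi u).
  pose f (u x : R) := cos (u * (x - m) + b) * pdf x.
  (* Any open interval around [u] would serve: the dominating function (1 + (y - m)^2) pdf y is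
     independent of the parameter. *)
  have uI : [set` `]u - 1, u + 1[] u by rewrite /= in_itv/= ltrBlDr ltrDl ltr01.
  have intf x : [set` `]u - 1, u + 1[] x ->
      mu.-integrable setT (EFin \o f x) by move=> _; exact: intcos.
  have derf x y : [set` `]u - 1, u + 1[] x -> setT y -> derivable (f ^~ y) x 1.
    by move=> _ _; have := dx x y => ?; exact: ex_derive.
  have G0 y : 0 <= (1 + 1 * (y - m) ^+ 2) * pdf y.
    by rewrite mulr_ge0 ?normal_pdf_ge0// addr_ge0// mul1r sqr_ge0.
  have fG x y : [set` `]u - 1, u + 1[] x -> setT y ->
     `|partial1of2 f x y| <= (1 + 1 * (y - m) ^+ 2) * pdf y.
    move=> _ _; rewrite partial1of2E; have [_ ->] := dx x y.
    rewrite normrM (ger0_norm (normal_pdf_ge0 _ _ _)) ler_wpM2r ?normal_pdf_ge0//.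
    rewrite normrN normrM mul1r (le_trans _ (normr_le_1Dsqr _))//.
    by rewrite ler_piMr// sin_max.
  have H := derivable_under_integral measurableT uI intf derf G0
    (integrable_quadratic_normal_pdf 1 1) fG.
  have E := differentiation_under_integral measurableT uI intf derf G0
    (integrable_quadratic_normal_pdf 1 1) fG.
  apply: DeriveDef => //.
  rewrite -derive1E E -stein_normal_pdf; apply: eq_Rintegral => x _.
  by rewrite partial1of2E; have [_ ->] := dx u x.
pose g (u : R) := phi u * expR (s ^+ 2 * u ^+ 2 / 2).
have dg (u : R) : is_derive u (1 : R) g 0.
  have d1 : is_derive u (1 : R) (fun u : R => s ^+ 2 * u ^+ 2 / 2) (s ^+ 2 * u).
    by apply: is_derive_eq; rewrite /GRing.scale/=; field.
  have d2 := @is_derive1_comp _ (@expR R) _ u _ _ (is_derive_expR _) d1.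
  have d3 := dphi u.
  by apply: is_derive_eq; rewrite /GRing.scale/=; ring.
have := is_derive_0_is_cst t 0 dg.
rewrite /g expr0n/= mulr0 mul0r expR0 mulr1 expRN => gE.
rewrite -/(phi t); apply: (canRL (mulfK _));
    first by rewrite gt_eqF ?invr_gt0 ?expR_gt0.
rewrite gE /phi.
under eq_Rintegral do rewrite mul0r add0r.
by rewrite RintegralZl//= /Rintegral ?integral_normal_pdf ?mulr1//;
    exact: integrable_normal_pdf.
Qed.

(** Integrals against [normal_prob] are computed through the Radon-Nikodym derivative. It agrees
    almost everywhere with the density because both have the same integral over every measurable
    set. *)
Lemma ae_eq_normal_prob : ae_eq mu setT
  (Radon_Nikodym_SigmaFinite.f (normal_prob m s) mu) (EFin \o pdf).
Proof.
have dom := normal_prob_dominates m s.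
apply: integral_ae_eq => //.
- exact: Radon_Nikodym_SigmaFinite.f_integrable.
- by apply/measurable_EFinP; exact: measurable_normal_pdf.
- by move=> A _ mA; rewrite -Radon_Nikodym_SigmaFinite.f_integral.
Qed.

Lemma ge0_integral_normal_prob (f : R -> R) : measurable_fun setT f ->
  (forall x, 0 <= f x) ->
  (\int[normal_prob m s]_x (f x)%:E = \int[mu]_x (f x * pdf x)%:E)%E.
Proof.
move=> mf f0; have dom := normal_prob_dominates m s.
rewrite -(Radon_Nikodym_SigmaFinite.change_of_variables dom)//;
    last exact/measurable_EFinP.
apply: ae_eq_integral => //.
- apply: emeasurable_funM; first exact/measurable_EFinP.
  exact: (measurable_int mu (Radon_Nikodym_SigmaFinite.f_integrable dom)).
- by apply/measurable_EFinP/measurable_funM => //; exact: measurable_normal_pdf.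
- under [X in ae_eq _ _ _ X]eq_fun do rewrite EFinM.
  exact: ae_eqe_mul2l ae_eq_normal_prob.
Qed.

Lemma integrable_normal_prob (f : R -> R) : measurable_fun setT f ->
  mu.-integrable setT (fun x => (f x * pdf x)%:E) ->
  (normal_prob m s).-integrable setT (EFin \o f).
Proof.
move=> mf /integrableP[_ fi]; apply/integrableP; split; first exact/measurable_EFinP.
rewrite (_ : (fun x => _) = (fun x => (`|f x|)%:E))//.
rewrite ge0_integral_normal_prob//; last exact: measurableT_comp.
move: fi; congr (_ < _)%E; apply: eq_integral => x _.
by rewrite /= normrM (ger0_norm (normal_pdf_ge0 _ _ _)).
Qed.

Lemma Rintegral_normal_prob (f : R -> R) : measurable_fun setT f ->
  mu.-integrable setT (fun x => (f x * pdf x)%:E) ->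
  \int[normal_prob m s]_x f x = \int[mu]_x (f x * pdf x).
Proof.
move=> mf fi; have fi' := integrable_normal_prob mf fi.
have dom := normal_prob_dominates m s.
rewrite /Rintegral; congr fine.
rewrite -(Radon_Nikodym_change_of_variables dom)//.
apply: ae_eq_integral => //.
- by apply: emeasurable_funM; first exact/measurable_EFinP.
- by apply/measurable_EFinP/measurable_funM => //; exact: measurable_normal_pdf.
- under [X in ae_eq _ _ _ X]eq_fun do rewrite EFinM.
  apply: ae_eqe_mul2l; apply: ae_eq_trans ae_eq_normal_prob.
  exact/ae_eq_sym/ae_eq_Radon_Nikodym_SigmaFinite.
Qed.

End normal.

Lemma Rintegral_probability_cst d (T : measurableType d) (R : realType)
  (P : probability T R) (c : R) : \int[P]_w (fun=> c) w = c.
Proof. by rewrite /Rintegral integral_cst//= probability_setT mule1. Qed.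

Section normal_random_variable.
Context d (T : measurableType d) (R : realType) (P : probability T R).
Variables (X : T -> R) (m s : R).
Hypothesis measX : measurable_fun setT X.
Hypothesis lawX : forall A : set R, measurable A -> P (X @^-1` A) = normal_law m s A.
Local Notation mu := (@lebesgue_measure R).

(* The canonical measurable structures on [R] and on [measurableTypeR R] have
   the same measurable sets but different displays. *)
Let mX : measurable_fun setT (X : T -> measurableTypeR R).
Proof. by move=> _ A mA; exact: (measX measurableT). Qed.

Let X'_mixin := isMeasurableFun.Build _ _ T (measurableTypeR R) (X : T ->
    measurableTypeR R) mX.
Let X' : {mfun T >-> measurableTypeR R} := HB.pack (X : T ->
    measurableTypeR R) X'_mixin.

(** The nonnegative case asks for no integrability, and applied to absolute values it proves the
    integrability that [Rintegral_normal_law] depends on. *)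
Lemma ge0_integral_normal_law (f : R -> R) : measurable_fun setT f ->
  (forall x, 0 <= f x) ->
  (\int[P]_w (f (X w))%:E)%E =
   if s == 0 then (f m)%:E else (\int[normal_prob m s]_x (f x)%:E)%E.
Proof.
move=> mf f0; rewrite -(@ge0_integral_distribution _ _ _ (measurableTypeR R) _ _ X'
    (EFin \o f)) //; last exact/measurable_EFinP.
case: eqP => [s0|/eqP s0].
  rewrite (eq_measure_integral (@dirac _ (measurableTypeR R) m R)) => [|A mA _];
      last first.
    by move: (lawX mA); rewrite /normal_law s0 eqxx.
  by rewrite integral_dirac ?diracT ?mul1e//; exact/measurable_EFinP.
rewrite (eq_measure_integral (normal_prob m s)) => [//|A mA _].
by move: (lawX mA); rewrite /normal_law (negbTE s0).
Qed.

Lemma integrable_normal_law (f : R -> R) : measurable_fun setT f ->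
  (s != 0 -> mu.-integrable setT (fun x => (f x * normal_pdf m s x)%:E)) ->
  P.-integrable setT (fun w => (f (X w))%:E).
Proof.
move=> mf fi; apply/integrableP; split.
  by apply/measurable_EFinP; exact: measurableT_comp.
rewrite (_ : (fun x => _) = (fun w => ((fun y => `|f y|) (X w))%:E))//.
rewrite (ge0_integral_normal_law (f := fun y => `|f y|))//;
    last exact: measurableT_comp.
case: eqP => [_|/eqP s0]; first exact: ltry.
by have /integrableP[_] := integrable_normal_prob mf (fi s0).
Qed.

Lemma Rintegral_normal_law (f : R -> R) : measurable_fun setT f ->
  (s != 0 -> mu.-integrable setT (fun x => (f x * normal_pdf m s x)%:E)) ->
  \int[P]_w f (X w) =
  if s == 0 then f m else \int[mu]_x (f x * normal_pdf m s x).
Proof.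
move=> mf fi; rewrite /Rintegral -(@integral_distribution _ _ _ (measurableTypeR R)
    _ _ X' (EFin \o f)).
- case: eqP => [s0|/eqP s0].
    rewrite (eq_measure_integral (@dirac _ (measurableTypeR R) m R)) => [|A mA _];
        last first.
      by move: (lawX mA); rewrite /normal_law s0 eqxx.
    by rewrite integral_dirac ?diracT ?mul1e//; exact/measurable_EFinP.
  rewrite -/(Rintegral _ _ _) -Rintegral_normal_prob//; last exact: fi.
  rewrite (eq_measure_integral (normal_prob m s)) => [//|A mA _].
  by move: (lawX mA); rewrite /normal_law (negbTE s0).
- exact/measurable_EFinP.
- exact: integrable_normal_law.
Qed.

Lemma integrable_normal_rv_sqr : P.-integrable setT (fun w => ((X w) ^+ 2)%:E).
Proof.
apply: (integrable_normal_law (f := fun x => x ^+ 2)) => [|s0].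
  exact: measurable_funX.
apply: (le_integrableR (f := fun x =>
    x ^+ 2 * normal_pdf m s x) _ (integrable_quadratic_normal_pdf m s0 (2 * m ^+ 2)
    2)) => [|x].
  move=> y; have dp := is_derive_normal_pdf m s0 y.
  by apply/differentiable_continuous/derivable1_diffP; exact: ex_derive.
rewrite normrM (ger0_norm (normal_pdf_ge0 _ _ _)) ler_wpM2r ?normal_pdf_ge0//.
rewrite ger0_norm ?sqr_ge0// -subr_ge0.
have -> : 2 * m ^+ 2 + 2 * (x - m) ^+ 2 - x ^+ 2 = (x - 2 * m) ^+ 2 by ring.
exact: sqr_ge0.
Qed.

Lemma integrable_normal_rv : P.-integrable setT (fun w => (X w)%:E).
Proof.
apply: (integrable_normal_law (f := id)) => // s0.
apply: (le_integrableR (f := fun x =>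
    x * normal_pdf m s x) _ (integrable_quadratic_normal_pdf m s0 (1 + `|m|) 1)) =>
    [|x].
  move=> y; have dp := is_derive_normal_pdf m s0 y.
  by apply/differentiable_continuous/derivable1_diffP; exact: ex_derive.
rewrite normrM (ger0_norm (normal_pdf_ge0 _ _ _)) ler_wpM2r ?normal_pdf_ge0//.
rewrite mul1r -[x in `|x|](subrK m) (le_trans (ler_normD _ _))//.
by rewrite addrAC lerD2r normr_le_1Dsqr.
Qed.

Hypothesis X0 : \int[P]_w X w = 0.

Let iX1 : P.-integrable setT (EFin \o (fun w => X w)).
Proof. exact: integrable_normal_rv. Qed.

Let icst (c : R) : P.-integrable setT (EFin \o (fun=> c)).
Proof. exact: finite_measure_integrable_cst. Qed.

(** In [gaussian_vector] the parameters [m] and [s] are only asserted to exist. The zero mean of [X]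
    identifies the first, and [normal_law_variance] then identifies the square of the second. *)
Lemma normal_law_mean : m = 0.
Proof.
have [s0|s0] := eqVneq s 0.
  rewrite -X0 (Rintegral_normal_law (f := id))// ?s0 ?eqxx//.
have := Rintegral_normal_law (f := fun x => x - m).
rewrite (negbTE s0) mean_normal_pdf// RintegralB// X0.
rewrite Rintegral_probability_cst.
rewrite sub0r => /(_ (measurable_funB (@measurable_id _ _ _) (measurable_cst _))) H.
apply/eqP; rewrite -oppr_eq0; apply/eqP/H => _.
apply: (le_integrableR (f := fun x =>
    (x - m) * normal_pdf m s x) _ (integrable_quadratic_normal_pdf m s0 1 1)) => [|x].
  move=> y; have dp := is_derive_normal_pdf m s0 y.
  by apply/differentiable_continuous/derivable1_diffP; exact: ex_derive.
rewrite normrM (ger0_norm (normal_pdf_ge0 _ _ _)) ler_wpM2r ?normal_pdf_ge0//.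
by rewrite mul1r normr_le_1Dsqr.
Qed.

Lemma normal_law_variance : \int[P]_w (X w) ^+ 2 = s ^+ 2.
Proof.
have mX2 : measurable_fun setT (fun x : R => (x - m) ^+ 2).
  by apply: measurable_funX; exact: measurable_funB.
have -> : \int[P]_w (X w) ^+ 2 = \int[P]_w (fun x => (x - m) ^+ 2) (X w).
  by apply: eq_Rintegral => w _; rewrite normal_law_mean subr0.
rewrite (Rintegral_normal_law mX2) => [|s0]; last exact: integrable_sqr_normal_pdf.
case: eqP => [->|/eqP s0]; first by rewrite subrr.
exact: variance_normal_pdf.
Qed.

(** The right side is written with the second moment of [X], so that the existential parameters
    disappear and the degenerate and nondegenerate cases share one formula. *)
Lemma Rintegral_cos_normal_law (b : R) :
  \int[P]_w cos (X w + b) = cos b * expR (- (\int[P]_w (X w) ^+ 2 / 2)).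
Proof.
have mc : measurable_fun setT (fun x : R => cos (1 * (x - m) + b)).
  apply: measurableT_comp; first by apply: continuous_measurable_fun;
      exact: continuous_cos.
  by apply: measurable_funD => //; apply: measurable_funM => //; exact: measurable_funB.
have -> : \int[P]_w cos (X w + b) = \int[P]_w (fun x => cos (1 * (x - m) + b)) (X w).
  by apply: eq_Rintegral => w _; rewrite normal_law_mean subr0 mul1r.
rewrite normal_law_variance (Rintegral_normal_law mc) => [|s0].
  case: eqP => [->|/eqP s0].
    by rewrite subrr mul1r add0r expr0n/= mul0r oppr0 expR0 mulr1.
  by rewrite cos_normal_pdf// expr1n mulr1.
exact: integrable_cos_normal_pdf.
Qed.

End normal_random_variable.

(** * Gaussian vectors *)

Section integral_sum.
Context d (T : measurableType d) (R : realType) (mu : {measure set T -> \bar R}).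

Lemma integrable_sumr (I : Type) (r : seq I) (f : I -> T -> R) :
  (forall i, mu.-integrable setT (EFin \o f i)) ->
  mu.-integrable setT (EFin \o (fun x => \sum_(i <- r) f i x)).
Proof.
move=> fi; elim: r => [|i r IHr].
  rewrite (_ : _ \o _ = cst 0%E); first exact: integrable0.
  by apply/funext => x /=; rewrite big_nil.
rewrite (_ : _ \o _ = EFin \o (fun x => f i x + \sum_(i <- r) f i x)).
  exact: integrable_addr.
by apply/funext => x /=; rewrite big_cons.
Qed.

Lemma Rintegral_sum (I : Type) (r : seq I) (f : I -> T -> R) :
  (forall i, mu.-integrable setT (EFin \o f i)) ->
  \int[mu]_x (\sum_(i <- r) f i x) = \sum_(i <- r) \int[mu]_x f i x.
Proof.
move=> fi; elim: r => [|i r IHr].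
  rewrite big_nil -[RHS](Rintegral_set0 mu (fun=> 0)).
  under eq_Rintegral do rewrite big_nil.
  by rewrite /Rintegral !integral0.
rewrite big_cons -IHr -RintegralD//; last exact: integrable_sumr.
by apply: eq_Rintegral => x _; rewrite big_cons.
Qed.

End integral_sum.

Section gaussian_vector.
Context (R : realType) (I : finType) (d : measure_display)
  (T : measurableType d) (P : probability T R).
Variables (S : I -> I -> R) (G : I -> {RV P >-> R}).
Hypothesis G_gauss : centered_gaussian S G.

Let lincomb (a : I -> R) (w : T) : R := \sum_(j : I) a j * G j w.

Let measurable_lincomb a : measurable_fun setT (lincomb a).
Proof. by apply: measurable_sum => j; exact: measurable_funM. Qed.

Let lincomb_delta (l : I) : lincomb (fun j => (j == l)%:R) = G l.
Proof.
apply/funext => w; rewrite /lincomb (bigD1 l)//= eqxx mul1r big1 ?addr0// => j jl.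
by rewrite (negbTE jl) mul0r.
Qed.

Lemma gaussian_vector_integrable_sqr (l : I) :
  P.-integrable setT (fun w => ((G l w) ^+ 2)%:E).
Proof.
have [+ _ _] := G_gauss => /(_ (fun j => (j == l)%:R)) [m [s [_ lawG]]].
rewrite -/(lincomb _) lincomb_delta in lawG.
exact: integrable_normal_rv_sqr lawG.
Qed.

Lemma gaussian_vector_integrable (l : I) : P.-integrable setT (EFin \o G l).
Proof.
have [+ _ _] := G_gauss => /(_ (fun j => (j == l)%:R)) [m [s [_ lawG]]].
rewrite -/(lincomb _) lincomb_delta in lawG.
exact: integrable_normal_rv lawG.
Qed.

(** The hypothesis speaks of laws of linear combinations, not of products; the product is therefore
    dominated by the sum of the two squares. *)
Lemma gaussian_vector_integrableM (l h : I) :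
  P.-integrable setT (EFin \o (fun w => G l w * G h w)).
Proof.
apply: (le_integrable measurableT _ _ (integrable_addr
    (gaussian_vector_integrable_sqr l) (gaussian_vector_integrable_sqr h))).
  by apply/measurable_EFinP; exact: measurable_funM.
move=> w _; rewrite /= lee_fin.
set x := G l w; set y := G h w; rewrite [leRHS]ger0_norm ?addr_ge0 ?sqr_ge0//.
rewrite ler_norml; apply/andP; split; rewrite -subr_ge0 ?opprK.
  have -> : x * y + (x ^+ 2 + y ^+ 2) = (x + y / 2) ^+ 2 + 3 / 4 * y ^+ 2 by field.
  by rewrite addr_ge0 ?sqr_ge0// mulr_ge0 ?sqr_ge0.
have -> : x ^+ 2 + y ^+ 2 - x * y = (x - y / 2) ^+ 2 + 3 / 4 * y ^+ 2 by field.
by rewrite addr_ge0 ?sqr_ge0// mulr_ge0 ?sqr_ge0.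
Qed.

Lemma gaussian_vector_mean (l : I) : \int[P]_w G l w = 0.
Proof. by have [_ + _] := G_gauss => /(_ l);
    rewrite expectation_def /Rintegral => ->. Qed.

Lemma gaussian_vector_cov (l h : I) : \int[P]_w (G l w * G h w) = S l h.
Proof.
have [_ E0 /(_ l h)] := G_gauss; rewrite unlock !E0 /= unlock => H.
rewrite /Rintegral -[RHS]/(fine (S l h)%:E) -H; congr fine.
by apply: eq_integral => w _; rewrite !fctE/= !subr0.
Qed.

Lemma gaussian_vector_lincomb_mean a : \int[P]_w (lincomb a w) = 0.
Proof.
rewrite Rintegral_sum => [|j]; last exact/integrable_mulrl/gaussian_vector_integrable.
apply: big1 => j _; rewrite RintegralZl// ?gaussian_vector_mean ?mulr0//.
exact: gaussian_vector_integrable.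
Qed.

Lemma gaussian_vector_lincomb_sqr a :
  \int[P]_w (lincomb a w) ^+ 2 = \sum_(l : I) \sum_(h : I) a l * S l h * a h.
Proof.
under eq_Rintegral.
  move=> w _; rewrite expr2 mulr_suml.
  under eq_bigr => l _.
    rewrite mulr_sumr.
    under eq_bigr => h _ do rewrite mulrACA.
    over.
  over.
have intM l h : P.-integrable setT (EFin \o (fun w => a l * a h * (G l w * G h w))).
  exact/integrable_mulrl/gaussian_vector_integrableM.
rewrite Rintegral_sum => [|l]; last exact: integrable_sumr.
apply: eq_bigr => l _; rewrite Rintegral_sum//; apply: eq_bigr => h _.
rewrite RintegralZl//; last exact: gaussian_vector_integrableM.
by rewrite gaussian_vector_cov mulrAC.
Qed.

(** The characteristic function in real form: the phases 0 and - pi / 2 give its real and imaginary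
    parts. *)
Lemma gaussian_vector_cos a (b : R) :
  \int[P]_w cos (\sum_(j : I) a j * G j w + b) =
  cos b * expR (- ((\sum_(l : I) \sum_(h : I) a l * S l h * a h) / 2)).
Proof.
have [/(_ a) [m [s [_ lawG]]] _ _] := G_gauss.
rewrite (Rintegral_cos_normal_law (measurable_lincomb a) lawG).
  by rewrite gaussian_vector_lincomb_sqr.
exact: gaussian_vector_lincomb_mean.
Qed.

Lemma gaussian_vector_dist (l : I) (c : R) :
  \int[P]_w (G l w - c) ^+ 2 = S l l + c ^+ 2.
Proof.
have intG := gaussian_vector_integrable l.
have intG2 := gaussian_vector_integrableM l l.
have icst k : P.-integrable setT (EFin \o (fun=> k)) by exact:
    finite_measure_integrable_cst.
have E w : (G l w - c) ^+ 2 = G l w * G l w + (- (2 * c) * G l w + c ^+ 2) by ring.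
under eq_Rintegral do rewrite E.
rewrite RintegralD//; last exact/integrable_addr/icst/integrable_mulrl.
rewrite gaussian_vector_cov RintegralD//; last exact: integrable_mulrl.
by rewrite RintegralZl// gaussian_vector_mean mulr0 add0r Rintegral_probability_cst.
Qed.

(** Positive variance excludes the Dirac branch of [normal_law]; the other branch is dominated by
    Lebesgue measure, for which a point is null. *)
Lemma gaussian_vector_atomless (l : I) (x : R) :
    0 < S l l -> P [set w | G l w = x] = 0%E.
Proof.
move=> Sl0.
have [+ _ _] := G_gauss => /(_ (fun j => (j == l)%:R)) [m [s [_ lawG]]].
rewrite -/(lincomb _) lincomb_delta in lawG.
rewrite -[LHS]/(P (G l @^-1` [set x])) lawG; last exact: measurable_set1.
rewrite /normal_law ifF; last first.
  apply/negbTE; apply: contraTneq Sl0 => s0.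
  have := normal_law_variance (measurable_funPT (G l)) lawG (gaussian_vector_mean l).
  under eq_Rintegral do rewrite expr2.
  by rewrite gaussian_vector_cov s0 expr0n/= => ->; rewrite ltxx.
have /null_content_dominatesP := normal_prob_dominates m s.
by apply => //; exact: lebesgue_measure_set1.
Qed.

End gaussian_vector.

(** * Mean over words and its action on cosines *)

Section trigonometric_bounds.
Context {R : realType}.
Implicit Types x y h : R.

Let MVT_diff (f df : R -> R) x : 0 <= x ->
  (forall y : R, is_derive y (1 : R) f (df y)) ->
  exists2 c, 0 <= c <= x & f x - f 0 = df c * x.
Proof.
move=> x0 dff; have cf : {within `[0, x], continuous f}.
  apply: continuous_subspaceT => y.
  by apply/differentiable_continuous/derivable1_diffP; have := dff y => ?;
      exact: ex_derive.
have [c] := MVT_segment x0 (fun y _ => dff y) cf.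
by rewrite in_itv/= subr0 => cx ->; exists c.
Qed.

Lemma ler_norm_sin x : `|sin x| <= `|x|.
Proof.
wlog x0 : x / 0 <= x => [H|].
  case: (lerP 0 x) => [/H//|x0].
  by have := H (- x); rewrite sinN !normrN => -> //; rewrite oppr_ge0 ltW.
have [c _] := MVT_diff x0 (@is_derive_sin R).
by rewrite sin0 subr0 => ->; rewrite normrM ler_piMl// cos_max.
Qed.

Let cos_half x : cos x = 1 - 2 * sin (x / 2) ^+ 2.
Proof.
rewrite {1}(_ : x = (x / 2) *+ 2); last by field.
by rewrite cos_mulr2n cos2sin2; ring.
Qed.

Let sqr_ler_norm (a b : R) : `|a| <= `|b| -> a ^+ 2 <= b ^+ 2.
Proof. by rewrite -ler_sqr ?nnegrE// !real_normK ?num_real. Qed.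

Lemma ler_1Bcos x : 0 <= 1 - cos x <= x ^+ 2 / 2.
Proof.
rewrite cos_half opprB addrC subrK mulr_ge0 ?sqr_ge0//=.
have -> : x ^+ 2 / 2 = 2 * (x / 2) ^+ 2 by field.
by rewrite ler_pM2l// sqr_ler_norm// ler_norm_sin.
Qed.

(** Mean value theorem for y - sin y, whose derivative 1 - cos y is at most y^2 / 2. The constant is
    not sharp; only the cubic order matters. *)
Lemma ler_normBsin x : `|x - sin x| <= `|x| ^+ 3 / 2.
Proof.
wlog x0 : x / 0 <= x => [H|].
  case: (lerP 0 x) => [/H//|x0].
  by have := H (- x); rewrite sinN -opprD !normrN => -> //; rewrite oppr_ge0 ltW.
have df (y : R) : is_derive y (1 : R) (fun y => y - sin y) (1 - cos y).
  by apply: is_derive_eq.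
have [c /andP[c0 cx]] := MVT_diff x0 df.
rewrite sin0 !subr0 => ->; have /andP[c1 c2] := ler_1Bcos c.
rewrite normrM !ger0_norm// exprSr mulrAC ler_wpM2r//.
by rewrite (le_trans c2)// ler_pM2r ?invr_gt0// sqr_ler_norm// !ger0_norm.
Qed.

Lemma ler_normBcos x : `|cos x - 1 + x ^+ 2 / 2| <= `|x| ^+ 4.
Proof.
(* Since cos x = 1 - 2 sin (x / 2)^2, the left side is twice a difference of two squares, and the
   factor x / 2 - sin (x / 2) is already of third order. *)
have -> : cos x - 1 + x ^+ 2 / 2 = 2 * ((x / 2 - sin (x / 2)) * (x / 2 + sin (x / 2))).
  by rewrite cos_half; field.
rewrite !normrM [ `|2| ]ger0_norm//.
apply: (@le_trans _ _ (2 * ((`|x / 2| ^+ 3 / 2) * (`|x / 2| + `|x / 2|)))).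
  rewrite ler_pM2l// ler_pM// ?ler_normBsin// (le_trans (ler_normD _ _))//.
  by rewrite lerD2l ler_norm_sin.
rewrite normrM [ `|2^-1| ]ger0_norm// -subr_ge0; set z := `|x|.
have -> : z ^+ 4 - 2 * ((z / 2) ^+ 3 / 2 * (z / 2 + z / 2)) = 7 / 8 * z ^+ 4 by field.
by rewrite mulr_ge0// exprn_ge0 /z.
Qed.

(** The error does not depend on the base point [y]; this uniformity is what allows the one-step
    estimate to be iterated. *)
Lemma cos_taylor2 y h :
  `|cos (y + h) - (cos y - h * sin y - h ^+ 2 / 2 * cos y)| <= `|h| ^+ 3 + `|h| ^+ 4.
Proof.
have -> : cos (y + h) - (cos y - h * sin y - h ^+ 2 / 2 * cos y) =
    (h - sin h) * sin y + (cos h - 1 + h ^+ 2 / 2) * cos y.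
  by rewrite cosD; ring.
rewrite (le_trans (ler_normD _ _))// lerD// normrM.
  rewrite (le_trans (ler_piMr _ (sin_max _)))// (le_trans (ler_normBsin _))//.
  by rewrite ler_piMr ?exprn_ge0// invf_le1 ?ler1n.
by rewrite (le_trans (ler_piMr _ (cos_max _)))// ler_normBcos.
Qed.

(** The upper bound rests on expR x >= 1 + x and (1 + x) (1 - x + x^2) = 1 + x^3 >= 1. *)
Lemma expRN_taylor1 x : 0 <= x -> `|expR (- x) - (1 - x)| <= x ^+ 2.
Proof.
move=> x0; rewrite ler_norml; apply/andP; split.
  rewrite (@le_trans _ _ 0)// ?oppr_le0 ?sqr_ge0// subr_ge0.
  by have := expR_ge1Dx (- x).
rewrite lerBlDr expRN -(ler_pM2l (expR_gt0 x)) mulfV ?gt_eqF ?expR_gt0//.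
rewrite (@le_trans _ _ ((1 + x) * (x ^+ 2 + (1 - x))))//.
  rewrite -subr_ge0 (_ : _ - _ = x ^+ 3); last by ring.
  exact: exprn_ge0.
rewrite ler_wpM2r ?expR_ge1Dx//.
have -> : x ^+ 2 + (1 - x) = (x - 2^-1) ^+ 2 + 3 / 4 by field.
by rewrite addr_ge0 ?sqr_ge0.
Qed.

End trigonometric_bounds.

(** * Expectations over words of independent letters *)

Section path_mean.
Context (R : realType) (m : nat) (p : 'I_m -> R).
Hypothesis p_ge0 : forall i, 0 <= p i.
Hypothesis p_sum1 : \sum_(i < m) p i = 1.

(** The expectation of [g] at a word of n independent letters of law [p]. As an iterated finite sum
    it has independence built in and unfolds by conditioning on the first letter. *)
Fixpoint path_mean (n : nat) (g : seq 'I_m -> R) : R :=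
  if n is k.+1 then \sum_(i < m) p i * path_mean k (fun s => g (i :: s)) else g [::].

Lemma eq_path_mean n f g : (forall s, size s = n -> f s = g s) ->
  path_mean n f = path_mean n g.
Proof.
elim: n f g => [|n IHn] f g fg /=; first exact: fg.
by apply: eq_bigr => i _; congr (_ * _); apply: IHn => s sn; rewrite fg//= sn.
Qed.

Lemma le_path_mean n f g : (forall s, size s = n -> f s <= g s) ->
  path_mean n f <= path_mean n g.
Proof.
elim: n f g => [|n IHn] f g fg /=; first exact: fg.
by apply: ler_sum => i _; rewrite ler_wpM2l//; apply: IHn => s sn; rewrite fg//= sn.
Qed.

Lemma path_mean_cst n c : path_mean n (fun=> c) = c.
Proof. by elim: n => //= n ->; rewrite -mulr_suml p_sum1 mul1r. Qed.

Lemma path_meanD n f g :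
  path_mean n (fun s => f s + g s) = path_mean n f + path_mean n g.
Proof.
elim: n f g => //= n IHn f g; rewrite -big_split/=.
by apply: eq_bigr => i _; rewrite IHn mulrDr.
Qed.

Lemma path_meanZ n c f : path_mean n (fun s => c * f s) = c * path_mean n f.
Proof.
elim: n f => //= n IHn f; rewrite mulr_sumr.
by apply: eq_bigr => i _; rewrite IHn mulrCA.
Qed.

Lemma path_mean_sum n (I : Type) (r : seq I) (f : I -> seq 'I_m -> R) :
  path_mean n (fun s => \sum_(i <- r) f i s) = \sum_(i <- r) path_mean n (f i).
Proof.
elim: r => [|i r IHr].
  by rewrite big_nil -[RHS](path_mean_cst n 0); apply: eq_path_mean => s _;
      rewrite big_nil.
rewrite big_cons -IHr -path_meanD.
by apply: eq_path_mean => s _; rewrite big_cons.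
Qed.

(** The starting point [y] carries the induction: the first letter moves it to y + h i, and the
    cross term averages to 0 because the step is centred. *)
Lemma path_mean_sqr n (h : 'I_m -> R) y : \sum_(i < m) p i * h i = 0 ->
  path_mean n (fun s => (y + \sum_(i <- s) h i) ^+ 2) =
  y ^+ 2 + n%:R * \sum_(i < m) p i * h i ^+ 2.
Proof.
move=> h0; elim: n y => [|n IHn] y /=; first by rewrite big_nil addr0 mul0r addr0.
under eq_bigr => i _.
  rewrite (@eq_path_mean _ _ (fun s => (y + h i + \sum_(i <- s) h i) ^+ 2)); last first.
    by move=> s _; rewrite big_cons addrA.
  rewrite IHn (_ : p i * _ = p i * (y ^+ 2 + n%:R * \sum_(i < m) p i * h i ^+ 2) +
    (2 * y * (p i * h i) + p i * h i ^+ 2)); last by ring.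
  over.
rewrite !big_split/= -mulr_suml p_sum1 mul1r -mulr_sumr h0 mulr0 add0r.
by rewrite -addrA -[n.+1%:R]natr1 mulrDl mul1r.
Qed.

(** One-step errors add up. The induction hypothesis holds at every starting point, so averaging
    over the first letter keeps the error n k of the remaining steps, and the new error is
    multiplied by exp (- n v) <= 1. *)
Lemma path_mean_cos_le (h : 'I_m -> R) (k v : R) : 0 <= v ->
  (forall y, `|\sum_(i < m) p i * cos (y + h i) - expR (- v) * cos y| <= k) ->
  forall n y, `|path_mean n (fun s => cos (y + \sum_(i <- s) h i)) -
    expR (- (n%:R * v)) * cos y| <= n%:R * k.
Proof.
move=> v0 hk; elim=> [|n IHn] y /=.
  by rewrite big_nil addr0 !mul0r oppr0 expR0 mul1r subrr normr0.
under eq_bigr => i _.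
  rewrite (@eq_path_mean _ _ (fun s => cos (y + h i + \sum_(i <- s) h i))); last first.
    by move=> s _; rewrite big_cons addrA.
  over.
have -> : expR (- (n.+1%:R * v)) = expR (- (n%:R * v)) * expR (- v).
  by rewrite -expRD -[n.+1%:R]natr1; congr expR; ring.
set e := expR (- (n%:R * v)).
set A := \sum_(i < m) _.
have -> : A - e * expR (- v) * cos y =
  \sum_(i < m) p i * (path_mean n (fun s =>
      cos (y + h i + \sum_(i <- s) h i)) - e * cos (y + h i))
  + e * (\sum_(i < m) p i * cos (y + h i) - expR (- v) * cos y).
  under [in RHS]eq_bigr do rewrite mulrBr.
  rewrite sumrB -/A mulrBr mulr_sumr.
  under [in X in _ = _ + (X - _)]eq_bigr do rewrite mulrCA.
  by rewrite addrA subrK mulrA.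
rewrite -[n.+1%:R]natr1 mulrDl mul1r (le_trans (ler_normD _ _))// lerD//.
  rewrite (le_trans (ler_norm_sum _ _ _))//.
  apply: (@le_trans _ _ (\sum_(i < m) p i * (n%:R * k))).
    by apply: ler_sum => i _; rewrite normrM ger0_norm// ler_wpM2l.
  by rewrite -mulr_suml p_sum1 mul1r.
rewrite normrM ger0_norm ?expR_ge0// (le_trans _ (hk y))// ler_piMl//.
by rewrite /e -expR0 ler_expR oppr_le0 mulr_ge0.
Qed.

(** The linear term averages to 0, and the factor 1 - v left by the quadratic term is replaced by
    exp (- v). One eta^4 comes from [cos_taylor2], the other from v^2 with v <= eta^2. *)
Lemma mean_cos_taylor (h : 'I_m -> R) (eta y : R) :
  \sum_(i < m) p i * h i = 0 -> (forall i, `|h i| <= eta) ->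
  `|\sum_(i < m) p i * cos (y + h i) -
    expR (- ((\sum_(i < m) p i * h i ^+ 2) / 2)) * cos y| <= eta ^+ 3 + 2 * eta ^+ 4.
Proof.
move=> h0 heta; set v := (\sum_(i < m) _) / 2.
have v0 : 0 <= v by rewrite divr_ge0// sumr_ge0// => i _; rewrite mulr_ge0 ?sqr_ge0.
(* An empty sum would not be 1, so there is a letter, and its bound gives [0 <= eta]. *)
have m0 : (0 < m)%N.
  rewrite lt0n; apply/eqP => m0; move: (oner_neq0 R).
  by rewrite -p_sum1 big1 ?eqxx// => i; have := ltn_ord i; rewrite {2}m0.
have eta0 : 0 <= eta := le_trans (normr_ge0 _) (heta (Ordinal m0)).
have veta : v <= eta ^+ 2.
  rewrite ler_pdivrMr// (@le_trans _ _ (\sum_(i < m) p i * eta ^+ 2))//.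
    apply: ler_sum => i _; rewrite ler_wpM2l// -[leLHS]real_normK ?num_real//.
    by rewrite ler_sqr ?nnegrE.
  by rewrite -mulr_suml p_sum1 mul1r ler_peMr ?sqr_ge0// ler1n.
have -> : \sum_(i < m) p i * cos (y + h i) - expR (- v) * cos y =
  \sum_(i < m) p i * (cos (y + h i) - (cos y - h i * sin y - h i ^+ 2 / 2 * cos y))
  - (expR (- v) - (1 - v)) * cos y.
  under [in RHS]eq_bigr => i _.
    rewrite (_ : p i * _ = p i * cos (y + h i) - (p i * cos y) +
        (p i * h i * sin y) + p i * h i ^+ 2 * (cos y / 2)); last by field.
    over.
  rewrite !big_split/= sumrN -!mulr_suml p_sum1 h0.
  by rewrite /v; field.
rewrite (le_trans (ler_normB _ _))// (mulr_natl _ 2) mulr2n addrA lerD//.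
  rewrite (le_trans (ler_norm_sum _ _ _))//.
  apply: (@le_trans _ _ (\sum_(i < m) p i * (eta ^+ 3 + eta ^+ 4))).
    apply: ler_sum => i _; rewrite normrM ger0_norm// ler_wpM2l//.
    by rewrite (le_trans (cos_taylor2 _ _))// lerD// lerXn2r ?nnegrE.
  by rewrite -mulr_suml p_sum1 mul1r.
rewrite normrM (le_trans (ler_piMr _ (cos_max _)))// (le_trans (expRN_taylor1 v0))//.
by rewrite (_ : eta ^+ 4 = (eta ^+ 2) ^+ 2); [rewrite ler_sqr ?nnegrE ?sqr_ge0|ring].
Qed.

Lemma cvg_path_mean_cos (u : 'I_m -> R) (b : R) : \sum_(i < m) p i * u i = 0 ->
  path_mean n (fun s => cos (b + (\sum_(i <- s) u i) / Num.sqrt n%:R)) @[n --> \oo]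
  --> cos b * expR (- ((\sum_(i < m) p i * u i ^+ 2) / 2)).
Proof.
move=> u0.
pose B := \sum_(i < m) `|u i|.
have uB i : `|u i| <= B by rewrite /B (bigD1 i)//= lerDl sumr_ge0.
have B0 : 0 <= B by rewrite sumr_ge0.
apply/cvgrPdist_le => e e0; near=> n.
have n0 : (0 < n)%N by near: n; exists 1.
set q := Num.sqrt n%:R.
have q0 : 0 < q by rewrite sqrtr_gt0 ltr0n.
have qq : q ^+ 2 = n%:R by rewrite sqr_sqrtr.
pose h i := u i / q.
have h0 : \sum_(i < m) p i * h i = 0.
  by under eq_bigr do rewrite mulrA; rewrite -mulr_suml u0 mul0r.
have hB i : `|h i| <= B / q.
  by rewrite normrM [ `|q^-1| ]ger0_norm ?invr_ge0 ?(ltW q0)// ler_pM2r ?invr_gt0.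
have v0 : 0 <= (\sum_(i < m) p i * h i ^+ 2) / 2.
  by rewrite divr_ge0// sumr_ge0// => i _; rewrite mulr_ge0 ?sqr_ge0.
have := path_mean_cos_le v0 (fun y => mean_cos_taylor y h0 hB) n b.
have -> : n%:R * ((\sum_(i < m) p i * h i ^+ 2) / 2) =
    (\sum_(i < m) p i * u i ^+ 2) / 2.
  rewrite mulrA mulr_sumr; congr (_ / 2); apply: eq_bigr => i _.
  by rewrite /h expr_div_n qq; field; rewrite pnatr_eq0 -lt0n.
rewrite (@eq_path_mean _ _ (fun s => cos (b + (\sum_(i <- s) u i) / q))); last first.
  by move=> s _; rewrite mulr_suml.
rewrite mulrC distrC => /le_trans; apply.
(* As q^2 = n, the n errors of order q^-3 add up to order q^-1, which tends to 0. *)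
have -> : n%:R * ((B / q) ^+ 3 + 2 * (B / q) ^+ 4) = (B ^+ 3 + 2 * B ^+ 4 / q) / q.
  by rewrite -qq; field; rewrite gt_eqF.
have q1 : 1 <= q by rewrite -sqrtr1 ler_sqrt ?ler1n.
rewrite ler_pdivrMr// (@le_trans _ _ (B ^+ 3 + 2 * B ^+ 4))//.
  by rewrite lerD2l ler_pdivrMr// ler_peMr// mulr_ge0// exprn_ge0.
rewrite -ler_pdivrMl//; set C := e^-1 * _.
have C0 : 0 <= C by rewrite mulr_ge0 ?invr_ge0 ?(ltW e0)// addr_ge0 ?exprn_ge0//
    mulr_ge0 ?exprn_ge0.
rewrite -(ger0_norm C0) -sqrtr_sqr ler_sqrt//.
by near: n; exact: nbhs_infty_ger.
Unshelve. all: by end_near. Qed.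

End path_mean.

(** * Words of an i.i.d. sequence *)

Section iid_words.
Context (R : realType) (m : nat) (p : 'I_m -> R)
  (d : measure_display) (T : measurableType d) (P : probability T R)
  (idx : nat -> T -> 'I_m).
Hypothesis idx_iid : iid_indices p P idx.

Definition word (n : nat) (w : T) : seq 'I_m := mkseq (fun k => idx k w) n.

Let size_word n w : size (word n w) = n.
Proof. exact: size_mkseq. Qed.

Let K (n : nat) : {fset nat} := seq_fset tt (iota 0 n).

Let memK n k : (k \in K n) = (k < n)%N.
Proof. by rewrite seq_fsetE mem_iota. Qed.

(** Independence in [iid_indices] concerns finite sets of times, hence the set [K]. The type ['I_m]
    has no canonical letter, so the default of [nth] is the tested letter itself; it is never
    returned because k < size t. *)
Let word_eqE t : [set w | word (size t) w = t] =
  \bigcap_(k in [set` K (size t)]) (idx k @^-1` [set i | nth i t k = i]).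
Proof.
apply/seteqP; split=> [w /= wt k|w wt].
  by rewrite /mkset memK => kt /=; rewrite -[in LHS]wt nth_mkseq.
rewrite /=; case: t wt => [//|i0 t] wt; apply: (@eq_from_nth _ i0);
    first exact: size_word.
move=> k; rewrite size_word => kt; rewrite nth_mkseq//.
rewrite -(wt k); last by rewrite /mkset memK.
exact: set_nth_default.
Qed.

Lemma measurable_word_eq t : measurable [set w | word (size t) w = t].
Proof.
rewrite word_eqE; apply: fin_bigcap_measurable; first exact: finite_fset.
by move=> k _; have [+ _ _] := idx_iid; apply.
Qed.

Lemma probability_word_eq t :
  P [set w | word (size t) w = t] = (\prod_(i <- t) p i)%:E.
Proof.
have [_ idxp indep] := idx_iid; rewrite word_eqE indep.
have -> : (\prod_(k <- K (size t)) P (idx k @^-1` [set i | nth i t k = i]) =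
    \prod_(k <- iota 0 (size t)) P (idx k @^-1` [set i | nth i t k = i]))%E.
  by apply: perm_big; rewrite (perm_trans (seq_fset_perm _ _))// undup_id ?iota_uniq.
case: t => [|i0 t]; first by rewrite !big_nil.
rewrite (big_nth i0) /index_iota subn0 -prodEFin !big_seq.
apply: eq_bigr => k; rewrite mem_iota add0n => kt.
rewrite -(idxp k); congr (P (_ @^-1` _)); apply/seteqP; split=> i /=.
  by rewrite (set_nth_default i0) => [//|]; exact: kt.
by move=> ->; exact: set_nth_default.
Qed.

Lemma measurable_word n (B : pred (seq 'I_m)) : measurable [set w | B (word n w)].
Proof.
have -> : [set w | B (word n w)] =
    \bigcup_t (if (size t == n) && B t then [set w | word (size t) w = t] else set0).
  apply/seteqP; split=> [w /= Bw|w /= [t _]].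
    by exists (word n w) => //; rewrite size_word eqxx Bw.
  by case: ifPn => // /andP[/eqP <- Bt] /= ->.
apply: countable_bigcupT_measurable; first exact: countableP.
by move=> t; case: ifP => // _; exact: measurable_word_eq.
Qed.

(** Generalises [probability_word] for an induction on the number of letters still free: with the
    prefix [t] fixed, the event is the disjoint union over the next letter, which joins the
    prefix. *)
Let probability_word_prefix n t (B : pred (seq 'I_m)) :
  P [set w | (word (size t) w == t) && B (word (size t + n) w)] =
  ((\prod_(i <- t) p i) * path_mean p n (fun s => (B (t ++ s))%:R))%:E.
Proof.
elim: n t => [|n IHn] t /=.
  rewrite cats0 addn0; case: (boolP (B t)) => Bt.
    rewrite mulr1 -probability_word_eq; congr (P _).
    by apply/seteqP; split=> [w /= /andP[/eqP//]|w /= E]; rewrite E eqxx Bt.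
  have -> : [set w | (word (size t) w == t) && B (word (size t) w)] = set0.
    by apply/seteqP; split=> [w /= /andP[/eqP ->]|//]; rewrite (negbTE Bt).
  by rewrite measure0 mulr0.
pose F (i : 'I_m) := [set w | (word (size (rcons t i)) w == rcons t i) &&
     B (word (size (rcons t i) + n) w)].
have -> : [set w | (word (size t) w == t) && B (word (size t + n.+1) w)] =
    \bigcup_(i in [set` predT]) F i.
  have wS k w : word k.+1 w = rcons (word k w) (idx k w).
    by rewrite /word mkseqS.
  apply/seteqP; split=> [w /= /andP[/eqP wt Bw]|w [i _]]; rewrite /F/=.
    exists (idx (size t) w) => //=.
    by rewrite size_rcons wS wt eqxx/= addSnnS Bw.
  by rewrite size_rcons wS eqseq_rcons addSnnS => /andP[/andP[-> _] ->].
rewrite bigcup_pred measure_bigsetU_ord; first last.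
- apply/trivIsetP => i j _ _ ij; apply/seteqP; split=> // w [] /=.
  rewrite /F/= !size_rcons => /andP[/eqP -> _] /andP[]; rewrite eqseq_rcons.
  by move=> /andP[_ ij'] _; move: ij; rewrite ij'.
- move=> i; rewrite (_ : F i = [set w | word (size (rcons t i)) w = rcons t i] `&`
      [set w | B (word (size (rcons t i) + n) w)]).
    by apply: measurableI; [exact: measurable_word_eq|exact: measurable_word].
  apply/seteqP; split=> w; first by move=> /andP[/eqP ? ?].
  by move=> [? ?]; apply/andP; split; [apply/eqP|].
rewrite mulr_sumr -sumEFin; apply: eq_bigr => i _; apply: etrans (IHn (rcons t i)) _.
rewrite -cats1 big_cat big_seq1/= mulrA; congr (_ * _)%:E.
by apply: eq_path_mean => s _; rewrite -catA.
Qed.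

Lemma probability_word n (B : pred (seq 'I_m)) :
  P [set w | B (word n w)] = (path_mean p n (fun s => (B s)%:R))%:E.
Proof.
have := probability_word_prefix n [::] B.
rewrite big_nil mul1r => <-; congr (P _).
Qed.

End iid_words.

(** * Polynomial approximation of a step function *)

Section polynomial_step.
Context {R : realType}.

Lemma bernoulli_ge (y : R) n : -1 <= y -> 1 + n%:R * y <= (1 + y) ^+ n.
Proof.
move=> y1; have y10 : 0 <= 1 + y by rewrite -lerBlDl sub0r.
elim: n => [|n IHn]; first by rewrite mul0r addr0 expr0.
rewrite exprS (le_trans _ (ler_wpM2l y10 IHn))// -subr_ge0.
have -> : (1 + y) * (1 + n%:R * y) - (1 + n.+1%:R * y) = n%:R * y ^+ 2.
  by rewrite -[n.+1%:R]natr1; ring.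
by rewrite mulr_ge0 ?sqr_ge0.
Qed.

(** Kuhn's polynomials from the elementary proof of the Weierstrass approximation theorem. The step
    sits at 1/2 because the exponent 2^n turns x^n into (2 x)^n. *)
Definition poly_step (n : nat) (x : R) : R := (1 - x ^+ n) ^+ (2 ^ n).

(** Left of 1/2, Bernoulli's inequality bounds the polynomial below by 1 - (2 x)^n. Right of 1/2 it
    is multiplied by (1 + x^n)^(2^n) >= 1 + (2 x)^n, and the product is at most 1. In both cases the
    error is at most 1 / (1 + 2 n a), again by Bernoulli. *)
Lemma poly_stepP (eta a : R) : 0 < eta -> 0 < a ->
  exists n, forall x, 0 <= x <= 1 ->
  [/\ 0 <= poly_step n x <= 1,
      x <= 2^-1 - a -> 1 - eta <= poly_step n x &
      2^-1 + a <= x -> poly_step n x <= eta].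
Proof.
move=> eta0 a0.
have [n Hn] : exists n, (1 + n%:R * (2 * a))^-1 <= eta.
  exists (Num.bound (eta^-1 / (2 * a))).
  rewrite -[leRHS]invrK lef_pV2 ?posrE ?invr_gt0// ?ltr_wpDr ?mulr_ge0 ?(ltW a0)//.
  rewrite ler_wpDl// -ler_pdivrMr ?mulr_gt0// ltW//.
  by rewrite archi_boundP// ?divr_ge0 ?invr_ge0 ?mulr_ge0 ?(ltW a0) ?(ltW eta0).
exists n => x /andP[x0 x1].
have xn0 : 0 <= x ^+ n by exact: exprn_ge0.
have xn1 : x ^+ n <= 1 by exact: exprn_ile1.
have pow2 : (2 ^ n)%:R = 2 ^+ n :> R by rewrite natrX.
split.
- by rewrite /poly_step exprn_ge0 ?exprn_ile1 ?subr_ge0// lerBlDr lerDl.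
- move=> xa; rewrite /poly_step.
  apply: (@le_trans _ _ (1 + (2 ^ n)%:R * (- x ^+ n))); last first.
    by apply: bernoulli_ge; rewrite lerN2.
  rewrite mulrN lerD2l lerN2 pow2 -exprMn (le_trans _ Hn)//.
  have b1 : 0 < 1 + 2 * a by rewrite ltr_wpDr ?mulr_ge0 ?(ltW a0).
  apply: (@le_trans _ _ ((1 + 2 * a)^-1 ^+ n)).
    rewrite lerXn2r ?nnegrE ?mulr_ge0 ?invr_ge0 ?(ltW b1)//.
    rewrite -[leRHS]mul1r ler_pdivlMr//.
    apply: (@le_trans _ _ ((1 - 2 * a) * (1 + 2 * a))).
      rewrite ler_pM2r//; lra.
    rewrite -subr_ge0 (_ : _ - _ = (2 * a) ^+ 2); last by ring.
    exact: sqr_ge0.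
  rewrite exprVn lef_pV2 ?posrE ?exprn_gt0// ?ltr_wpDr ?mulr_ge0 ?(ltW a0)//.
  by apply: bernoulli_ge; rewrite (@le_trans _ _ 0) ?mulr_ge0 ?(ltW a0)// oppr_le0.
- move=> xa; rewrite /poly_step (le_trans _ Hn)//.
  have c0 : 0 < 1 + n%:R * (2 * a) by rewrite ltr_wpDr ?mulr_ge0 ?(ltW a0).
  rewrite -[leRHS]mul1r ler_pdivlMr//.
  apply: (@le_trans _ _ ((1 - x ^+ n) ^+ (2 ^ n) * (1 + x ^+ n) ^+ (2 ^ n))).
    rewrite ler_wpM2l ?exprn_ge0 ?subr_ge0//.
    apply: (@le_trans _ _ (1 + (2 ^ n)%:R * x ^+ n)); last first.
      by apply: bernoulli_ge; rewrite (le_trans _ xn0)// oppr_le0.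
    rewrite pow2 -exprMn (@le_trans _ _ ((1 + 2 * a) ^+ n))//.
      by apply: bernoulli_ge; rewrite (@le_trans _ _ 0) ?mulr_ge0 ?(ltW a0)// oppr_le0.
    rewrite -[leLHS]add0r lerD//.
    rewrite lerXn2r ?nnegrE ?mulr_ge0 ?addr_ge0 ?mulr_ge0 ?(ltW a0)//.
    lra.
  rewrite -exprMn exprn_ile1//.
    by rewrite mulr_ge0 ?subr_ge0 ?addr_ge0.
  have -> : (1 - x ^+ n) * (1 + x ^+ n) = 1 - (x ^+ n) ^+ 2 by ring.
  by rewrite lerBlDr lerDl sqr_ge0.
Qed.

Definition trig_step (n : nat) (c K t : R) : R :=
  poly_step n ((1 + sin ((t - c) / K)) / 2).

(** Within distance [K] of [c] the argument of the sine stays in [-1, 1], where the sine increases.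
    Further away periodicity leaves only the bounds 0 and 1, so the last two claims are restricted
    to the window. *)
Lemma trig_stepP (c eps eta K : R) : 0 < eta -> 0 < eps -> eps <= K ->
  exists n, forall t,
  [/\ 0 <= trig_step n c K t <= 1,
      `|t - c| <= K -> t <= c - eps -> 1 - eta <= trig_step n c K t &
      `|t - c| <= K -> c + eps <= t -> trig_step n c K t <= eta].
Proof.
move=> eta0 eps0 epsK; have K0 : 0 < K := lt_le_trans eps0 epsK.
pose r := eps / K.
have r01 : 0 < r <= 1 by rewrite divr_gt0//= ler_pdivrMr ?mul1r.
have pi2 : 1 < pi / 2 :> R.
  rewrite lt_neqAle pihalf_ge1 andbT; apply/eqP => E.
  by have := @cos1_gt0 R; rewrite E cos_pihalf ltxx.
have inI (u : R) : `|u| <= 1 -> u \in `[- (pi / 2), pi / 2].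
  rewrite in_itv/= ler_norml => /andP[u1 u2]; apply/andP; split.
    by rewrite (le_trans _ u1)// lerN2 ltW.
  by rewrite (le_trans u2)// ltW.
have sin_le (u v : R) : `|u| <= 1 -> `|v| <= 1 -> u <= v -> sin u <= sin v.
  by move=> u1 v1 uv; rewrite leNgt ltr_sin ?inI// -leNgt.
(* The distance from 1/2 of (1 + sin ((t - c) / K)) / 2 when t is at distance [eps] from [c]. *)
pose a := sin r / 2.
have a0 : 0 < a.
  rewrite divr_gt0// sin_gt0_pihalf//; case/andP: r01 => -> r1 /=.
  exact: le_lt_trans r1 pi2.
have [n Hn] := poly_stepP eta0 a0; exists n => t.
have t01 : 0 <= (1 + sin ((t - c) / K)) / 2 <= 1.
  have := sin_le1 ((t - c) / K); have := sin_geN1 ((t - c) / K); lra.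
have [b1 b2 b3] := Hn _ t01.
have nr : `|r| <= 1 by rewrite ger0_norm; case/andP: r01 => // /ltW.
have nt : `|t - c| <= K -> `|(t - c) / K| <= 1.
  by move=> tc; rewrite normrM normfV [ `|K| ]gtr0_norm// ler_pdivrMr// mul1r.
split => // [tK tc|tK tc]; [apply: b2|apply: b3].
  have : sin ((t - c) / K) <= - sin r.
    rewrite -sinN sin_le ?nt// ?normrN//.
    rewrite /r -mulNr ler_pM2r ?invr_gt0//; lra.
  rewrite /a; lra.
have : sin r <= sin ((t - c) / K).
  rewrite sin_le ?nt// ler_pM2r ?invr_gt0//; lra.
rewrite /a; lra.
Qed.

Lemma prodr_ge1B (I : Type) (r : seq I) (f : I -> R) (eta : R) :
  (forall i, 0 <= f i <= 1) -> (forall i, 1 - eta <= f i) ->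
  1 - (size r)%:R * eta <= \prod_(i <- r) f i.
Proof.
move=> f01 feta; elim: r => [|i r IHr]; first by rewrite big_nil mul0r subr0.
rewrite big_cons /= -[(size r).+1%:R]natr1.
have /andP[fi0 fi1] := f01 i; have := feta i.
have : 0 <= \prod_(i <- r) f i by apply: prodr_ge0 => j _; case/andP: (f01 j).
have : \prod_(i <- r) f i <= 1 by apply: prodr_ile1 => j _; exact: f01.
move: IHr; set S := (size r)%:R; set Q := \prod_(i <- r) f i; set x := f i.
move=> SQ Q1 Q0 ex; have fx1 : x <= 1 by [].
have h1 : 0 <= (x - (1 - eta)) * Q by rewrite mulr_ge0// subr_ge0.
have h2 : 0 <= eta * (1 - Q) by rewrite mulr_ge0 ?subr_ge0//; lra.
lra.
Qed.

Context (J : finType).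

(** If some coordinate leaves the window, the tail is already at least 1 and both inequalities are
    trivial. Otherwise every factor is controlled by [trig_stepP], and a single small factor makes
    the product small. *)
Lemma trig_step_prodP (c eps eta K : R) : 0 < eta -> 0 < eps -> eps <= K ->
  exists n, forall x : J -> R,
  let Q := \prod_(j : J) trig_step n c K (x j) in
  let tail := \sum_(j : J) (x j - c) ^+ 2 / K ^+ 2 in
  [forall j, x j < c - eps]%:R <= Q + eta + tail /\
  Q <= [forall j, x j < c + eps]%:R + eta + tail.
Proof.
move=> eta0 eps0 epsK; have K0 : 0 < K := lt_le_trans eps0 epsK.
(* A product of #|J| factors, each at least 1 - eta', loses at most #|J| eta'; the successor avoids
   a division by 0 when J is empty. *)
pose eta' := eta / #|J|.+1%:R.
have eta'0 : 0 < eta' by rewrite divr_gt0.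
have eta'J : #|J|%:R * eta' <= eta.
  by rewrite /eta' mulrCA ler_piMr ?(ltW eta0)// ler_pdivrMr ?mul1r ?ler_nat.
have eta'1 : eta' <= eta by rewrite ler_pdivrMr// ler_peMr ?(ltW eta0)// ler1n.
have [n Hn] := trig_stepP c eta'0 eps0 epsK; exists n => x Q tail.
have tail0 : 0 <= tail by apply: sumr_ge0 => j _; rewrite divr_ge0 ?sqr_ge0.
have Q0 : 0 <= Q by apply: prodr_ge0 => j _; case: (Hn (x j)) => /andP[].
have Q1 : Q <= 1 by apply: prodr_ile1 => j _; case: (Hn (x j)).
have [far|] := boolP [exists j, K < `|x j - c|].
  have tail1 : 1 <= tail.
    have /existsP[j xj] := far; rewrite /tail (bigD1 j)//=.
    rewrite -[1]addr0 lerD//.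
      rewrite ler_pdivlMr ?exprn_gt0// mul1r -[leRHS]real_normK ?num_real//.
      by rewrite ler_sqr ?nnegrE// ltW.
    by apply: sumr_ge0 => i _; rewrite divr_ge0 ?sqr_ge0.
  split.
    by case: [forall _, _]; rewrite /=; lra.
  by case: [forall _, _]; rewrite /=; lra.
rewrite negb_exists => /forallP near; split.
  case: (boolP [forall _, _]) => [/forallP xc|_]; last by rewrite /=; lra.
  have : 1 - (size (enum J))%:R * eta' <= \prod_(j <- enum J) trig_step n c K (x j).
    apply: prodr_ge1B => j; first by case: (Hn (x j)).
    by case: (Hn (x j)) => _ + _; apply; [rewrite leNgt|exact: ltW].
  rewrite big_enum -/Q -cardE /= => ?; lra.
case: (boolP [forall _, _]) => [_|]; first by rewrite /=; lra.
rewrite negb_forall => /existsP[j]; rewrite -leNgt => xj.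
have : Q <= eta'.
  rewrite /Q (bigD1 j)//=.
  have [/andP[q0 q1] _ qe] := Hn (x j).
  rewrite (le_trans (ler_piMr q0 _))//.
    by apply: prodr_ile1 => i _; case: (Hn (x i)).
  by apply: qe => //; rewrite leNgt.
rewrite /=; lra.
Qed.

End polynomial_step.

(** * Central limit theorem for orthants *)

Section trigonometric_polynomials.
Context (R : realType) (J : finType).

(** Product is not a constructor: convergence of means is linear and goes by induction on this
    predicate, while closure under products is derived in [trigpolyM] from the product-to-sum
    formula. *)
Inductive trigpoly : ((J -> R) -> R) -> Prop :=
| trigpoly_cos (a : J -> R) (b : R) :
    trigpoly (fun x => cos (\sum_(j : J) a j * x j + b))
| trigpolyD f g : trigpoly f -> trigpoly g -> trigpoly (fun x => f x + g x)
| trigpolyZ c f : trigpoly f -> trigpoly (fun x => c * f x).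

Lemma eq_trigpoly f g : f =1 g -> trigpoly f -> trigpoly g.
Proof. by move=> /funext ->. Qed.

Lemma trigpoly_cst c : trigpoly (fun=> c).
Proof.
apply: (eq_trigpoly _ (trigpolyZ c (trigpoly_cos (fun=> 0) 0))) => x.
by rewrite big1 ?addr0 ?cos0 ?mulr1// => j _; rewrite mul0r.
Qed.

Lemma trigpolyM f g : trigpoly f -> trigpoly g -> trigpoly (fun x => f x * g x).
Proof.
move=> tf tg; elim: tf => {f} [a b|f1 f2 _ IH1 _ IH2|c f _ IH].
- elim: tg => {g} [a' b'|g1 g2 _ IH1 _ IH2|c g _ IH].
  + apply: (eq_trigpoly _ (trigpolyZ 2^-1 (trigpolyD
      (trigpoly_cos (fun j => a j + a' j) (b + b'))
      (trigpoly_cos (fun j => a j - a' j) (b - b'))))) => x.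
    have -> : \sum_j (a j + a' j) * x j + (b + b') =
        (\sum_j a j * x j + b) + (\sum_j a' j * x j + b').
      by under eq_bigr do rewrite mulrDl; rewrite big_split/=; ring.
    have -> : \sum_j (a j - a' j) * x j + (b - b') =
        (\sum_j a j * x j + b) - (\sum_j a' j * x j + b').
      by under eq_bigr do rewrite mulrBl; rewrite sumrB; ring.
    by rewrite cosD cosB; field.
  + by apply: eq_trigpoly (trigpolyD IH1 IH2) => x; rewrite mulrDr.
  + by apply: eq_trigpoly (trigpolyZ c IH) => x; rewrite mulrCA.
- by apply: eq_trigpoly (trigpolyD IH1 IH2) => x; rewrite mulrDl.
- by apply: eq_trigpoly (trigpolyZ c IH) => x; rewrite mulrA.
Qed.

Lemma trigpolyX f n : trigpoly f -> trigpoly (fun x => f x ^+ n).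
Proof.
move=> tf; elim: n => [|n IHn].
  by apply: eq_trigpoly (trigpoly_cst 1) => x; rewrite expr0.
by apply: eq_trigpoly (trigpolyM tf IHn) => x; rewrite exprS.
Qed.

Lemma trigpoly_prod (I : Type) (r : seq I) (f : I -> (J -> R) -> R) :
  (forall i, trigpoly (f i)) -> trigpoly (fun x => \prod_(i <- r) f i x).
Proof.
move=> tf; elim: r => [|i r IHr].
  by apply: eq_trigpoly (trigpoly_cst 1) => x; rewrite big_nil.
by apply: eq_trigpoly (trigpolyM (tf i) IHr) => x; rewrite big_cons.
Qed.

Lemma trigpoly_step n c K (j : J) : trigpoly (fun x => trig_step n c K (x j)).
Proof.
apply: trigpolyX.
have tX : trigpoly (fun x => ((1 + sin ((x j - c) / K)) / 2) ^+ n).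
  apply: trigpolyX.
  (* The phase - pi / 2 makes the cosine a sine. *)
  apply: (eq_trigpoly _ (trigpolyZ 2^-1 (trigpolyD (trigpoly_cst 1)
    (trigpoly_cos (fun i => (i == j)%:R / K) (- c / K - pi / 2))))) => x.
  rewrite (bigD1 j)//= eqxx big1 ?addr0 => [|i ij]; last first.
    by rewrite (negbTE ij) !mul0r.
  have -> : 1 / K * x j + (- c / K - pi / 2) = (x j - c) / K - pi / 2 by ring.
  by rewrite cosBpihalf mulrC.
by apply: (eq_trigpoly _ (trigpolyD (trigpoly_cst 1) (trigpolyZ (-1) tX))) => x;
    rewrite mulN1r.
Qed.

End trigonometric_polynomials.

Section central_limit.
Context (R : realType) (m : nat) (p : 'I_m -> R) (J : finType)
  (v : J -> 'I_m -> R) (S : J -> J -> R).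
Hypothesis p_ge0 : forall i, 0 <= p i.
Hypothesis p_sum1 : \sum_(i < m) p i = 1.
Hypothesis v_centered : forall j, \sum_(i < m) p i * v j i = 0.
Hypothesis S_cov : forall l h, S l h = \sum_(i < m) p i * v l i * v h i.
Context (d : measure_display) (T : measurableType d) (P : probability T R)
  (G : J -> {RV P >-> R}).
Hypothesis G_gauss : centered_gaussian S G.

Definition nsum (j : J) (s : seq 'I_m) : R :=
  (\sum_(i <- s) v j i) / Num.sqrt (size s)%:R.

Let Gv (w : T) (j : J) : R := G j w.

Lemma trigpoly_integrable f : trigpoly f ->
  P.-integrable setT (EFin \o (fun w => f (Gv w))).
Proof.
elim=> {f} [a b|f g _ IHf _ IHg|c f _ IH].
- have mf : measurable_fun setT (fun w => cos (\sum_(j : J) a j * Gv w j + b)).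
    apply: measurableT_comp; first by apply: continuous_measurable_fun;
        exact: continuous_cos.
    apply: measurable_funD => //.
    by apply: measurable_sum => j; exact: measurable_funM.
  apply: (@le_integrable _ _ _ P setT measurableT _ (EFin \o (fun=> 1))).
  + exact/measurable_EFinP.
  + by move=> w _; rewrite /= lee_fin normr1 cos_max.
  + exact: finite_measure_integrable_cst.
- exact: integrable_addr.
- exact: integrable_mulrl.
Qed.

(** The Cramer-Wold reduction: a cosine of a linear form sees only the scalar walk with steps sum_j
    a_j v_j(i), whose variance is the quadratic form of [S] at [a]. *)
Lemma cvg_path_mean_trigpoly f : trigpoly f ->
  path_mean p n (fun s => f (nsum ^~ s)) @[n --> \oo] --> \int[P]_w f (Gv w).
Proof.
elim=> {f} [a b|f g tf IHf tg IHg|c f tf IH].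
- rewrite (gaussian_vector_cos G_gauss).
  pose u i := \sum_(j : J) a j * v j i.
  have -> : \sum_(l : J) \sum_(h : J) a l * S l h * a h = \sum_(i < m) p i * u i ^+ 2.
    transitivity (\sum_(i < m) \sum_(l : J) \sum_(h : J) p i * (a l * v l i * (a h
        * v h i))).
      rewrite [RHS]exchange_big/=; apply: eq_bigr => l _.
      rewrite [RHS]exchange_big/=; apply: eq_bigr => h _.
      rewrite S_cov mulr_sumr mulr_suml; apply: eq_bigr => i _; ring.
    apply: eq_bigr => i _; rewrite expr2 /u mulr_suml mulr_sumr.
    by apply: eq_bigr => l _; rewrite !mulr_sumr.
  have u0 : \sum_(i < m) p i * u i = 0.
    rewrite /u; under eq_bigr do rewrite mulr_sumr.
    rewrite exchange_big/= big1// => j _.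
    by under eq_bigr do rewrite mulrCA; rewrite -mulr_sumr v_centered mulr0.
  have := cvg_path_mean_cos p_ge0 p_sum1 (b := b) u0; apply: cvg_trans.
  apply: near_eq_cvg; apply: nearW => n; apply: eq_path_mean => s sn.
  congr cos; rewrite addrC; congr (_ + _).
  rewrite /u exchange_big/= mulr_suml; apply: eq_bigr => j _.
  by rewrite /nsum sn -mulr_sumr mulrA.
- rewrite RintegralD//; [|exact: trigpoly_integrable..].
  have -> : (fun n => path_mean p n (fun s => f (nsum ^~ s) + g (nsum ^~ s))) =
      (fun n => path_mean p n (fun s => f (nsum ^~ s)) + path_mean p n (fun s =>
          g (nsum ^~ s))).
    by apply/funext => n; rewrite path_meanD.
  exact: cvgD.
- rewrite RintegralZl//; last exact: trigpoly_integrable.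
  have -> : (fun n => path_mean p n (fun s => c * f (nsum ^~ s))) =
      (fun n => c * path_mean p n (fun s => f (nsum ^~ s))).
    by apply/funext => n; rewrite path_meanZ.
  by apply: cvgM => //; exact: cvg_cst.
Qed.

(** The same value as in [gaussian_vector_dist], so one window radius serves both the walk and the
    Gaussian vector. *)
Lemma path_mean_nsum_sqr n j c : (0 < n)%N ->
  path_mean p n (fun s => (nsum j s - c) ^+ 2) = S j j + c ^+ 2.
Proof.
move=> n0; pose q : R := Num.sqrt n%:R.
have q2 : q ^+ 2 = n%:R by rewrite sqr_sqrtr.
have q0 : q != 0 by rewrite sqrtr_eq0 -ltNge ltr0n.
rewrite (@eq_path_mean _ _ p n _ (fun s => (- c + \sum_(i <- s) v j i / q) ^+ 2));
    last first.
  by move=> s sn; rewrite /nsum sn -/q addrC mulr_suml.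
rewrite path_mean_sqr//; last first.
  by under eq_bigr do rewrite mulrA; rewrite -mulr_suml v_centered mul0r.
rewrite S_cov sqrrN addrC mulr_sumr; congr (_ + _).
apply: eq_bigr => i _; rewrite -q2 expr_div_n; field.
exact: q0.
Qed.

Let below (c : R) (w : T) : R := [forall j, G j w < c]%:R.

Lemma measurable_gaussian_below c : measurable [set w | [forall j, G j w < c]].
Proof.
have -> : [set w | [forall j,
    G j w < c]] = \bigcap_(j in [set: J]) (G j @^-1` [set x | x < c]).
  by apply/seteqP; split=> [w /= /forallP Gc j _|w Gc];
      [exact: Gc|apply/forallP => j; exact: Gc].
by apply: fin_bigcap_measurable => // j _; exact: measurable_fun_lt.
Qed.

Let belowE c : below c = \1_[set w | [forall j, G j w < c]].
Proof. by apply/funext => w; rewrite /below indicE mem_setE. Qed.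

Let integrable_below c : P.-integrable setT (EFin \o below c).
Proof.
rewrite belowE; apply: integrable_indic => //.
  exact: measurable_gaussian_below.
Qed.

Let Rintegral_below c : \int[P]_w below c w = fine (P [set w | [forall j, G j w < c]]).
Proof.
by rewrite belowE /Rintegral integral_indic ?setIT//; exact: measurable_gaussian_below.
Qed.

Theorem clt_forall_lt (c eps eta : R) : 0 < eps -> 0 < eta ->
  \forall n \near \oo,
    path_mean p n (fun s => [forall j, nsum j s < c - eps]%:R) <=
      fine (P [set w | [forall j, G j w < c + eps]]) + eta /\
    fine (P [set w | [forall j, G j w < c - eps]]) <=
      path_mean p n (fun s => [forall j, nsum j s < c + eps]%:R) + eta.
Proof.
move=> eps0 eta0.
(* Five errors [e] add up: the approximation error and the tail on each of the two sides, and the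
   distance between the two means of [Q]. *)
have [e e0 etaE] : exists2 e, 0 < e & eta = 5 * e.
  by exists (eta / 5); [rewrite divr_gt0|field].
pose C := \sum_(j : J) (S j j + c ^+ 2).
have C0 : 0 <= C.
  apply: sumr_ge0 => j _; rewrite addr_ge0 ?sqr_ge0// S_cov sumr_ge0// => i _.
  by rewrite -mulrA mulr_ge0// -expr2 sqr_ge0.
(* K >= eps is needed by [trig_step_prodP]; K >= 1 and K >= C / e give C / K^2 <= e, the bound on
   the expected tails. *)
pose K := 1 + eps + C / e.
have Ce0 : 0 <= C / e by rewrite divr_ge0// ltW.
have K1 : 1 <= K by rewrite /K -addrA lerDl addr_ge0// ltW.
have K0 : 0 < K := lt_le_trans ltr01 K1.
have epsK : eps <= K by rewrite /K; lra.
have CK : C / K ^+ 2 <= e.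
  rewrite ler_pdivrMr ?exprn_gt0// -ler_pdivrMl// mulrC.
  apply: (@le_trans _ _ K); first by rewrite /K; lra.
  by rewrite expr2 ler_peMr// ltW.
have [N HN] := trig_step_prodP J c e0 eps0 epsK.
pose Q (x : J -> R) := \prod_(j : J) trig_step N c K (x j).
pose tail (x : J -> R) := \sum_(j : J) (x j - c) ^+ 2 / K ^+ 2.
have tQ : trigpoly Q by apply: trigpoly_prod => j; exact: trigpoly_step.
have iQ := trigpoly_integrable tQ.
have itail1 j : P.-integrable setT (EFin \o (fun w => (Gv w j - c) ^+ 2)).
  have E : (fun w => (Gv w j - c) ^+ 2) = (fun w =>
      Gv w j * Gv w j + (- (2 * c) * Gv w j + c ^+ 2)).
    by apply/funext => w; ring.
  rewrite E; apply: integrable_addr; first exact: (gaussian_vector_integrableM G_gauss).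
  apply: integrable_addr; last exact: finite_measure_integrable_cst.
  exact/integrable_mulrl/(gaussian_vector_integrable G_gauss).
have itail2 j : P.-integrable setT (EFin \o (fun w => (Gv w j - c) ^+ 2 / K ^+ 2)).
  have -> : (fun w => (Gv w j - c) ^+ 2 / K ^+ 2) = (fun w =>
      (K ^+ 2)^-1 * (Gv w j - c) ^+ 2).
    by apply/funext => w; rewrite mulrC.
  exact: integrable_mulrl.
have itail : P.-integrable setT (EFin \o (fun w => tail (Gv w))).
  exact: integrable_sumr.
have Etail : \int[P]_w tail (Gv w) <= e.
  apply: le_trans CK; rewrite Rintegral_sum// /C mulr_suml; apply: ler_sum => j _.
  under eq_Rintegral do rewrite mulrC.
  by rewrite RintegralZl// (gaussian_vector_dist G_gauss) mulrC.
have icst : P.-integrable setT (EFin \o (fun=> e)) by exact: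
    finite_measure_integrable_cst.
near=> n.
have n0 : (0 < n)%N by near: n; exists 1.
have ntail : path_mean p n (fun s => tail (nsum ^~ s)) <= e.
  apply: le_trans CK; rewrite path_mean_sum// /C mulr_suml; apply: ler_sum => j _.
  rewrite (@eq_path_mean _ _ p n _ (fun s => (K ^+ 2)^-1 * (nsum j s - c) ^+ 2));
      last first.
    by move=> s _; rewrite mulrC.
  by rewrite path_meanZ path_mean_nsum_sqr// mulrC.
have /ler_normlP[Q1 Q2] : `|\int[P]_w Q (Gv w) - path_mean p n (fun s =>
    Q (nsum ^~ s))| <= e.
  near: n; move/cvgrPdist_le : (cvg_path_mean_trigpoly tQ); exact.
split.
  have U1 : path_mean p n (fun s => [forall j, nsum j s < c - eps]%:R) <=
      path_mean p n (fun s => Q (nsum ^~ s)) + e + path_mean p n (fun s =>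
          tail (nsum ^~ s)).
    rewrite -[e in X in _ <= X](path_mean_cst p_sum1 n) -!path_meanD.
    by apply: le_path_mean => // s _; have [] := HN (nsum ^~ s).
  have U2 : \int[P]_w Q (Gv w) <=
      \int[P]_w below (c + eps) w + e + \int[P]_w tail (Gv w).
    rewrite -[e in X in _ <= X](Rintegral_probability_cst P).
    rewrite -!RintegralD//; [|exact: integrable_addr..].
    apply: le_Rintegral => //; first by do 2 apply: integrable_addr => //.
    by move=> w _; have [] := HN (Gv w).
  rewrite Rintegral_below in U2; lra.
have U1 : path_mean p n (fun s => Q (nsum ^~ s)) <=
    path_mean p n (fun s => [forall j,
        nsum j s < c + eps]%:R) + e + path_mean p n (fun s => tail (nsum ^~ s)).
  rewrite -[e in X in _ <= X](path_mean_cst p_sum1 n) -!path_meanD.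
  by apply: le_path_mean => // s _; have [] := HN (nsum ^~ s).
have U2 : \int[P]_w below (c - eps) w <= \int[P]_w Q (Gv w) + e + \int[P]_w tail (Gv w).
  rewrite -[e in X in _ <= X](Rintegral_probability_cst P).
  rewrite -!RintegralD//; [|exact: integrable_addr..].
  apply: le_Rintegral => //; first by do 2 apply: integrable_addr => //.
  by move=> w _; have [] := HN (Gv w).
rewrite Rintegral_below in U2; lra.
Unshelve. all: by end_near. Qed.

End central_limit.

(** * From distribution functions to weak convergence *)

Section uniform_continuity.
Context {R : realType}.

(** Only [x] is confined to the segment, because the last cell of the grid in
    [levy_cvg_in_distribution] overshoots its right end. *)
Lemma segment_uniform_continuous (f : R -> R) (a b e : R) : continuous f -> 0 < e ->
  exists2 delta, 0 < delta & forall x y, a <= x <= b -> `|x - y| < delta ->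
      `|f x - f y| <= e.
Proof.
move=> cf e0.
have /compact_near_coveringP cov := @segment_compact _ a b.
have := cov R (0^'+) (fun delta x => forall y, `|x - y| < delta -> `|f x - f y| <= e) _.
case.
  move=> x _; have e20 : 0 < e / 2 by rewrite divr_gt0.
  have /cvgrPdist_le/(_ _ e20) := cf x.
  move=> /nbhs_ballP[r /= r0 fr].
  exists (ball x (r / 2), [set d | d < r / 2]).
    split=> /=; first by apply: nbhsx_ballx; rewrite divr_gt0.
    by apply: nbhs_right_lt; rewrite divr_gt0.
  move=> [x' d] /= [xx' dr] y x'y.
  have h1 : `|f x - f x'| <= e / 2.
    by apply: fr; apply: le_ball xx'; rewrite ler_pdivrMr// ler_peMr ?(ltW r0)// ler1n.
  have h2 : `|f x - f y| <= e / 2.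
    apply: fr; rewrite /ball/= -[x](subrK x') -addrA.
    rewrite (le_lt_trans (ler_normD _ _))// (splitr r) ltrD//.
    exact: lt_trans x'y dr.
  rewrite -[f x'](subrK (f x)) -addrA (le_trans (ler_normD _ _))// (splitr e) lerD//.
  by rewrite distrC.
move=> r /= r0 Hr; exists (r / 2); first by rewrite divr_gt0.
move=> x y axb xy; apply: (Hr (r / 2) _ _ x) => //.
- by rewrite /ball_/= sub0r normrN ger0_norm ?divr_ge0 ?(ltW r0)// ltr_pdivrMr//
    ltr_pMr// ltr1n.
- by rewrite divr_gt0.
Qed.

End uniform_continuity.

Lemma tight_lt d (T : measurableType d) (R : realType) (P : probability T R)
  (f : T -> R) (e : R) : measurable_fun setT f -> 0 < e ->
  exists2 L, 0 <= L & fine (P [set w | f w < - L]) <= e /\ 1 - e <=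
      fine (P [set w | f w < L]).
Proof.
move=> mf e0.
pose f' : {mfun T >-> R} := HB.pack f (isMeasurableFun.Build _ _ _ _ f mf).
have cN : cdf (f' : {RV P >-> R}) x @[x --> -oo%R] --> 0%:E := @cvg_cdfNy0 _ _ _ P f'.
have cy : cdf (f' : {RV P >-> R}) x @[x --> +oo%R] --> 1%:E := @cvg_cdfy1 _ _ _ P f'.
have {}cN : fine (cdf (f' : {RV P >-> R}) x) @[x --> -oo%R] --> (0 : R) by exact:
    fine_cvg cN.
have {}cy : fine (cdf (f' : {RV P >-> R}) x) @[x --> +oo%R] --> (1 : R) by exact:
    fine_cvg cy.
have /cvgrPdist_le/(_ _ e0)[A [_ HA]] := cN.
have /cvgrPdist_le/(_ _ e0)[B [_ HB]] := cy.
have cdfE x : cdf (f' : {RV P >-> R}) x = P [set w | f w <= x].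
  by congr (P _); apply/seteqP; split=> w; rewrite /= in_itv.
have mle x : measurable [set w | f w <= x].
  rewrite -[X in measurable X]setTI; apply: (mf measurableT [set y | y <= x]).
  have -> : [set y : R | y <= x] = `]-oo, x]%classic by apply/seteqP; split=> y;
      rewrite /= in_itv.
  exact: measurable_itv.
(* One unit gets strictly beyond [A] and [B], the other passes from the closed half-line of [cdf] to
   the open one. *)
exists (`|A| + `|B| + 2); first by rewrite !addr_ge0.
have nA := ler_norm (- A); have nB := ler_norm B; rewrite normrN in nA.
have nA0 := normr_ge0 A; have nB0 := normr_ge0 B.
split.
  apply: (@le_trans _ _ (fine (cdf (f' : {RV P >-> R}) (- (`|A| + `|B| + 2))))).
    rewrite cdfE fine_le ?fin_num_measure//; first exact: measurable_fun_lt.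
    by rewrite le_measure ?inE//; [exact: measurable_fun_lt|move=> w /= /ltW].
  have := HA (- (`|A| + `|B| + 2)) ltac:(lra).
  by rewrite sub0r normrN; apply: le_trans; exact: ler_norm.
apply: (@le_trans _ _ (fine (cdf (f' : {RV P >-> R}) (`|A| + `|B| + 1)))).
  have := HB (`|A| + `|B| + 1) ltac:(lra).
  move=> /ler_normlP[_]; lra.
rewrite cdfE fine_le ?fin_num_measure//; first exact: measurable_fun_lt.
rewrite le_measure ?inE//; first exact: measurable_fun_lt.
move=> w /= /le_lt_trans; apply; lra.
Qed.

(** Abel summation: the staircase equal to f (c k) on the k-th cell is written with indicators of
    half-lines, so that its expectation involves only the distribution function. Outside the grid
    the error is the oscillation 2 M. *)
Lemma step_approx (R : realType) (f : R -> R) (N : nat) (c : nat -> R) (e M : R) :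
  0 <= e -> (forall x, `|f x| <= M) -> (forall k, c k <= c k.+1) ->
  (forall k (x : R), (k < N)%N -> c k <= x <= c k.+1 -> `|f (c k) - f x| <= e) ->
  forall x,
  `|f x - (f (c N) - \sum_(0 <= k < N) (f (c k.+1) - f (c k)) * (x < c k.+1)%R%:R)| <=
    e + 2 * M * ((x < c 0%N)%R%:R + (1 - (x < c N)%R%:R)).
Proof.
move=> e0 fM cS fe x.
have M0 : 0 <= M := le_trans (normr_ge0 _) (fM 0).
have cmono i j : (i <= j)%N -> c i <= c j.
  by move=> /subnKC <-; elim: (j - i)%N => [|k IHk];
      rewrite ?addn0// addnS (le_trans IHk).
have f2M y z : `|f y - f z| <= 2 * M.
  by rewrite (le_trans (ler_normB _ _))// mulr_natl mulr2n lerD.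
have [x0|x0] := ltP x (c 0%N).
  have -> : \sum_(0 <= k < N) (f (c k.+1) - f (c k)) * (x < c k.+1)%R%:R =
      f (c N) - f (c 0%N).
    rewrite -(telescope_sumr (f \o c))//; apply: eq_bigr => k _.
    by rewrite (lt_le_trans x0) ?cmono// mulr1.
  rewrite subKr (lt_le_trans x0) ?cmono// subrr addr0 mulr1.
  by rewrite (le_trans (f2M _ _))// lerDr.
have [xN|xN] := ltP x (c N); last first.
  rewrite big_nat_cond big1 => [|k /andP[/andP[_ kN] _]]; last first.
    by rewrite ltNge (le_trans _ xN) ?cmono// mulr0.
  by rewrite subr0 add0r subr0 mulr1 (le_trans (f2M _ _))// lerDr.
rewrite subrr addr0 mulr0 addr0.
have [k kN /andP[ck xk]] : exists2 k, (k < N)%N & c k <= x < c k.+1.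
  elim: (N) xN => [|n IHn xn]; first by rewrite ltNge x0.
  have [/IHn[k kn xk]|cx] := ltP x (c n); first by exists k => //; exact: ltnW.
  by exists n => //; rewrite cx.
have -> : \sum_(0 <= k < N) (f (c k.+1) - f (c k)) * (x < c k.+1)%R%:R =
    f (c N) - f (c k).
  rewrite (@big_cat_nat _ _ _ k) ?(ltnW kN)//= big_nat_cond big1 ?add0r =>
      [|i /andP[/andP[_ ik] _]]; last first.
    by rewrite ltNge (le_trans _ ck) ?cmono// mulr0.
  rewrite -(telescope_sumr (f \o c)) ?(ltnW kN)//; apply: eq_big_nat => i /andP[ki _].
  by rewrite (lt_le_trans xk) ?mulr1// cmono.
by rewrite subKr distrC fe// ck ltW.
Qed.

Section weak_convergence.
Context (R : realType) (dO : measure_display) (Omega : measurableType dO)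
  (P : probability Omega R) (X : nat -> Omega -> R)
  (dY : measure_display) (OmegaY : measurableType dY)
  (Q : probability OmegaY R) (Y : OmegaY -> R).
Hypothesis mX : forall n, measurable_fun setT (X n).
Hypothesis mY : measurable_fun setT Y.
Let F n (x : R) : R := fine (P [set w | X n w < x]).
Let F' (x : R) : R := fine (Q [set w | Y w < x]).
Hypothesis levy : forall x eps eta, 0 < eps -> 0 < eta ->
  \forall n \near \oo, F n (x - eps) <= F' (x + eps) + eta /\ F' (x - eps) <=
      F n (x + eps) + eta.

(** The hypothesis at c + delta / 2 and c - delta / 2 puts the whole shift on the side of the
    limit. *)
Let levy' c delta eta : 0 < delta -> 0 < eta ->
  \forall n \near \oo, F n c <= F' (c + delta) + eta /\ F' (c - delta) <= F n c + eta.
Proof.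
move=> d0 eta0; have d20 : 0 < delta / 2 by rewrite divr_gt0.
near=> n.
have [h1 _] : F n (c + delta / 2 - delta / 2) <= F' (c + delta / 2 + delta / 2) + eta /\
    F' (c + delta / 2 - delta / 2) <=
        F n (c + delta / 2 + delta / 2) + eta by near: n; exact: levy.
have [_ h2] : F n (c - delta / 2 - delta / 2) <= F' (c - delta / 2 + delta / 2) + eta /\
    F' (c - delta / 2 - delta / 2) <=
        F n (c - delta / 2 + delta / 2) + eta by near: n; exact: levy.
by move: h1 h2; rewrite addrK subrK -!addrA -opprD -!splitr.
Unshelve. all: by end_near. Qed.

Lemma levy_cvg_cdf (x : R) :
  {for x, continuous (fun y : R => Q [set w | Y w < y])} ->
  (fun n => P [set w | X n w < x]) @ \oo --> Q [set w | Y w < x].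
Proof.
move=> cx.
have PXE n : P [set w | X n w < x] =
    (F n x)%:E by rewrite fineK ?fin_num_measure//; exact: measurable_fun_lt.
have QYE y : Q [set w | Y w < y] = (F' y)%:E by rewrite fineK ?fin_num_measure//;
    exact: measurable_fun_lt.
have cF' : {for x, continuous F'}.
  have cx' : Q [set w | Y w < y] @[y --> x] --> (F' x)%:E by rewrite -QYE; exact: cx.
  exact: fine_cvg cx'.
under eq_fun do rewrite PXE.
rewrite QYE; apply/cvg_EFin; first exact: nearW.
apply/cvgrPdist_le => e e0.
have e20 : 0 < e / 2 by rewrite divr_gt0.
have /cvgrPdist_le/(_ _ e20) := cF'.
move=> /nbhs_ballP[r /= r0 Fr].
have r20 : 0 < r / 2 by rewrite divr_gt0.
near=> n.
have [h1 h2] : F n x <= F' (x + r / 2) + e / 2 /\ F' (x - r / 2) <= F n x + e / 2.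
  by near: n; exact: levy'.
have : `|F' x - F' (x + r / 2)| <= e / 2.
  apply: Fr; rewrite /ball/= opprD addNKr normrN ger0_norm; lra.
have : `|F' x - F' (x - r / 2)| <= e / 2.
  apply: Fr; rewrite /ball/= opprB addrC subrK ger0_norm; lra.
rewrite !ler_norml => /andP[? ?] /andP[? ?]; apply/andP; split; lra.
Unshelve. all: by end_near. Qed.

Lemma expectation_step_le d (T : measurableType d) (mu : probability T R)
  (Z : T -> R) (H : R -> R) (f : R -> R) (N : nat) (c : nat -> R) (e M : R) :
  measurable_fun setT Z -> continuous f ->
  0 <= e -> (forall x, `|f x| <= M) -> (forall k, c k <= c k.+1) ->
  (forall k (x : R), (k < N)%N -> c k <= x <= c k.+1 -> `|f (c k) - f x| <= e) ->
  (forall x, H x = fine (mu [set w | Z w < x])) ->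
  `|\int[mu]_w f (Z w) - (f (c N) - \sum_(0 <=
      k < N) (f (c k.+1) - f (c k)) * H (c k.+1))| <=
    e + 2 * M * (H (c 0%N) + (1 - H (c N))).
Proof.
move=> mZ cf e0 fM cS fe HE.
have icst k : mu.-integrable setT (EFin \o (fun=> k)) by exact:
    finite_measure_integrable_cst.
have bE x : (fun w => (Z w < x)%R%:R) = \1_[set w | Z w < x] :> (T -> R).
  by apply/funext => w; rewrite indicE mem_setE.
have ib x : mu.-integrable setT (EFin \o (fun w => (Z w < x)%R%:R)).
  by rewrite bE; apply: integrable_indic => //; exact: measurable_fun_lt.
have Hb x : \int[mu]_w (Z w < x)%R%:R = H x.
  by rewrite HE bE /Rintegral integral_indic ?setIT//; exact: measurable_fun_lt.
have ifZ : mu.-integrable setT (EFin \o (fun w => f (Z w))).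
  apply: (@le_integrable _ _ _ mu setT measurableT _ (EFin \o (fun=> M))) => //.
    by apply/measurable_EFinP; apply: measurableT_comp => //;
        exact: continuous_measurable_fun.
  by move=> w _; rewrite /= lee_fin (le_trans (fM _))// ler_norm.
pose g w := f (c N) - \sum_(0 <= k < N) (f (c k.+1) - f (c k)) * (Z w < c k.+1)%R%:R.
have isum : mu.-integrable setT (EFin \o
    (fun w => \sum_(0 <= k < N) (f (c k.+1) - f (c k)) * (Z w < c k.+1)%R%:R)).
  by apply: integrable_sumr => k; exact: integrable_mulrl.
have ig : mu.-integrable setT (EFin \o g) by exact: integrable_subr.
have <- : \int[mu]_w g w = f (c N) - \sum_(0 <=
    k < N) (f (c k.+1) - f (c k)) * H (c k.+1).
  rewrite RintegralB// Rintegral_probability_cst Rintegral_sum => [|k];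
      last exact: integrable_mulrl.
  by congr (_ - _); apply: eq_bigr => k _; rewrite RintegralZl// Hb.
rewrite -RintegralB// (le_trans (le_normr_Rintegral _ _))//;
    first exact: integrable_subr.
have iR : mu.-integrable setT (EFin \o (fun w =>
    2 * M * ((Z w < c 0%N)%R%:R + (1 - (Z w < c N)%R%:R)))).
  by apply/integrable_mulrl/integrable_addr => //; exact: integrable_subr.
have <- : \int[mu]_w (e + 2 * M * ((Z w < c 0%N)%R%:R + (1 - (Z w < c N)%R%:R))) =
    e + 2 * M * (H (c 0%N) + (1 - H (c N))).
  rewrite RintegralD// Rintegral_probability_cst RintegralZl//; last first.
    by apply: integrable_addr => //; exact: integrable_subr.
  rewrite RintegralD//; last exact: integrable_subr.
  by rewrite RintegralB// Rintegral_probability_cst !Hb.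
apply: le_Rintegral => //.
- have := integrable_abse (integrable_subr ifZ ig); exact.
- exact: integrable_addr.
- by move=> w _; exact: step_approx.
Qed.

(** The Levy shift is taken equal to the mesh of the grid, so the gap between the two distribution
    functions at a grid point is at most an increment of [F'] over two cells, plus [eta]. These
    increments telescope, so grid points may be discontinuities of [F']. *)
Theorem levy_cvg_in_distribution : cvg_in_distribution P X Q Y.
Proof.
move=> f cf [M fM].
have M0 : 0 <= M := le_trans (normr_ge0 _) (fM 0).
have mf : measurable_fun setT f by exact: continuous_measurable_fun.
have EE d (T : measurableType d) (mu : probability T R) (Z : T -> R) :
    measurable_fun setT Z -> 'E_mu[f \o Z]%E = (\int[mu]_w f (Z w))%:E.
  move=> mZ; rewrite unlock /Rintegral fineK//; apply: integrable_fin_num => //.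
  apply: (@le_integrable _ _ _ mu setT measurableT _ (EFin \o (fun=> M))) => //.
  - by apply/measurable_EFinP; exact: measurableT_comp.
  - by move=> w _; rewrite /= lee_fin (le_trans (fM _))// ler_norm.
  - exact: finite_measure_integrable_cst.
under eq_fun do rewrite EE//.
rewrite EE//; apply/cvg_EFin; first exact: nearW.
apply/cvgrPdist_le => e e0 /=.
have [e1 e10 eE] : exists2 e1, 0 < e1 & e = 10 * e1.
  by exists (e / 10); [rewrite divr_gt0|field].
(* The tails outside the grid cost 2 M (4 t) for X and 2 M (2 t) for Y, together 12 M t <= e / 2 = 5
   e1. The other 5 e1 are one for each staircase and three for their difference. The summand [e] in
   the denominator ensures t <= 1. *)
pose t := e / (24 * (M + 1) + e).
have den0 : 0 < 24 * (M + 1) + e by rewrite addr_gt0// mulr_gt0// ltr_wpDl.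
have t0 : 0 < t by rewrite divr_gt0.
have t1 : t <= 1 by rewrite ler_pdivrMr// mul1r lerDr mulr_ge0// addr_ge0.
have tM : 12 * (M * t) <= e / 2.
  have -> : 12 * (M * t) = 12 * M * e / (24 * (M + 1) + e) by rewrite /t; ring.
  rewrite ler_pdivrMr//.
  have := mulr_ge0 (ltW e0) (ltW e0); nra.
have [L L0 [F'L1 F'L2]] := tight_lt Q mY t0.
have {}F'L1 : F' (- L) <= t by [].
have {}F'L2 : 1 - t <= F' L by [].
have [delta0 delta00 unif] := segment_uniform_continuous (- (L + 1)) (L + 1) cf e10.
have [delta [delta_gt0 delta_le1 delta_lt]] : exists delta, [/\ 0 < delta,
    delta <= 1 & delta < delta0].
  exists (Num.min 1 (delta0 / 2)); rewrite lt_min ge_min lexx/= divr_gt0// ltr01;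
      split=> //.
  by rewrite gt_min; apply/orP; right; rewrite ltr_pdivrMr// ltr_pMr// ltr1n.
pose N := (Num.trunc ((2 * L + 2) / delta)).+1.
have /andP[N1 N2] := @truncn_itv _ ((2 * L +
    2) / delta) ltac:(by rewrite divr_ge0 ?(ltW delta_gt0)// addr_ge0// mulr_ge0).
rewrite -/N in N2.
rewrite ler_pdivlMr// in N1; rewrite ltr_pdivrMr// in N2.
pose c (k : nat) := - (L + 1) + k%:R * delta.
have cSE k : c k.+1 = c k + delta by rewrite /c -[k.+1%:R]natr1; ring.
have cS k : c k <= c k.+1 by rewrite cSE lerDl ltW.
have fc k x : (k < N)%N -> c k <= x <= c k.+1 -> `|f (c k) - f x| <= e1.
  move=> kN; rewrite cSE => /andP[ckx xck]; apply: unif.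
    have kN' : k%:R * delta <= (Num.trunc ((2 * L + 2) / delta))%:R * delta.
      by rewrite ler_pM2r// ler_nat.
    rewrite /c lerDl mulr_ge0 ?(ltW delta_gt0)//=; lra.
  rewrite distrC ger0_norm ?subr_ge0//; lra.
pose eta := t / N.+1%:R; have eta0 : 0 < eta by rewrite divr_gt0.
have etaN : N%:R * eta <= 1.
  by rewrite /eta mulrA ler_pdivrMr// mul1r (le_trans (ler_piMr _ t1))// ler_nat.
have etat : eta <= t by rewrite ler_pdivrMr// ler_peMr ?(ltW t0)// ler1n.
have F'mono x y : x <= y -> F' x <= F' y.
  move=> xy; rewrite fine_le ?fin_num_measure//; [exact: measurable_fun_lt..|].
  by rewrite le_measure ?inE//;
      [exact: measurable_fun_lt..|move=> w /= /lt_le_trans; apply].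
have F'01 x : 0 <= F' x <= 1.
  rewrite fine_ge0//= -[1]/(fine 1%:E) fine_le ?fin_num_measure//;
      first exact: measurable_fun_lt.
  by rewrite probability_le1//; exact: measurable_fun_lt.
have c0E : c 0%N = - (L + 1) by rewrite /c mul0r addr0.
have cNL : L + 1 <= c N by rewrite /c; lra.
near=> n.
have FF (k : 'I_N.+1) : F n (c k) <= F' (c k + delta) + eta /\ F' (c k - delta) <=
    F n (c k) + eta.
  by move: k; near: n; apply: filter_forall => k; exact: levy'.
have [F0 _] := FF ord0; have [_ FN] := FF ord_max.
rewrite /= in F0 FN.
have F0t : F n (c 0%N) <= 2 * t.
  rewrite (le_trans F0)// mulr_natl mulr2n lerD// (le_trans _ F'L1)// F'mono// c0E; lra.
have FNt : 1 - F n (c N) <= 2 * t.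
  have : F' L <= F' (c N - delta) by apply: F'mono; lra.
  lra.
have hX := @expectation_step_le _ _ P (X n) (F n) f N c e1 M (mX n) cf (ltW e10) fM
    cS fc (fun=> erefl).
have hY := @expectation_step_le _ _ Q Y F' f N c e1 M mY cf (ltW e10) fM cS fc
    (fun=> erefl).
set gX := f (c N) - \sum_(0 <= k < N) (f (c k.+1) - f (c k)) * F n (c k.+1).
set gY := f (c N) - \sum_(0 <= k < N) (f (c k.+1) - f (c k)) * F' (c k.+1).
have hg : `|gX - gY| <= 3 * e1.
  have -> : gX - gY = \sum_(0 <=
      k < N) (f (c k.+1) - f (c k)) * (F' (c k.+1) - F n (c k.+1)).
    by under [in RHS]eq_bigr do rewrite mulrBr; rewrite sumrB /gX /gY; ring.
  rewrite (le_trans (ler_norm_sum _ _ _))//.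
  (* The telescoping sum is at most 2 because [F'] lies in [0, 1], and the terms [eta] add up to at
     most 1; hence 3 e1 whatever the number of cells. *)
  apply: (@le_trans _ _ (\sum_(0 <=
      k < N) e1 * ((F' (c k.+2) + F' (c k.+1)) - (F' (c k.+1) + F' (c k)) + eta))).
    rewrite !big_nat; apply: ler_sum => k /andP[_ kN].
    rewrite normrM ler_pM//.
      by rewrite distrC fc// lexx cS.
    have [h1 h2] := FF (Ordinal (kN : (k.+1 < N.+1)%N)).
    rewrite /= -cSE in h1; rewrite /= {1}cSE addrK in h2.
    have m1 : F' (c k) <= F' (c k.+1) by exact: F'mono.
    have m2 : F' (c k.+1) <= F' (c k.+2) by exact: F'mono.
    by rewrite ler_norml; apply/andP; split; lra.
  rewrite -mulr_sumr mulrC ler_pM2r// big_split/= (telescope_sumr (fun k =>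
      F' (c k.+1) + F' (c k)))//.
  rewrite big_const_nat iter_addr_0 subn0 -mulr_natl.
  have /andP[? ?] := F'01 (c N.+1); have /andP[? ?] := F'01 (c N).
  have /andP[? ?] := F'01 (c 1%N); have /andP[? ?] := F'01 (c 0%N).
  lra.
move: hX hY; rewrite -/gX -/gY.
set EX := \int[P]_w _; set EY := \int[Q]_w _ => hX hY.
have hX' : 2 * M * (F n (c 0%N) + (1 - F n (c N))) <= 2 * M * (4 * t).
  by rewrite ler_wpM2l ?mulr_ge0//; lra.
have hY' : 2 * M * (F' (c 0%N) + (1 - F' (c N))) <= 2 * M * (2 * t).
  rewrite ler_wpM2l ?mulr_ge0//.
  have : F' (c 0%N) <= F' (- L) by apply: F'mono; lra.
  have : F' L <= F' (c N) by apply: F'mono; lra.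
  lra.
rewrite -(subrK gY EY) -[X in `|_ - X|](subrK gX EX).
have -> : EY - gY + gY - (EX - gX + gX) = (EY - gY) - (EX - gX) - (gX - gY) by ring.
rewrite (le_trans (ler_normB _ _))// (le_trans (lerD (ler_normB _ _) (lexx _)))//.
lra.
Unshelve. all: by end_near. Qed.

End weak_convergence.

(** * Spectral radius of products of triangular matrices *)

Section spectral_radius_triangular.
Context {R : realType}.

Let C := R[i].

Lemma char_poly_tr (F : comNzRingType) d (A : 'M[F]_d) : char_poly A^T = char_poly A.
Proof.
rewrite /char_poly -[RHS]det_tr; congr (\det _).
by apply/matrixP => i j; rewrite !mxE eq_sym.
Qed.

Lemma maxf_lt (I : finType) (g : I -> R) (i0 : I) (x : R) :
  (maxf g < x) = [forall i, g i < x].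
Proof.
have [[k kE] gle] := maxfP g i0; apply/idP/forallP => [gx i|gx].
  exact: le_lt_trans (gle i) gx.
by rewrite -kE.
Qed.

(** [is_trig_mx] means lower triangular; the upper triangular case goes through the transpose, which
    has the same characteristic polynomial and diagonal. *)
Lemma spectral_radius_trig d (A : 'M[C]_d) : is_trig_mx A \/ is_trig_mx A^T ->
  spectral_radius A = maxf (fun j => cmod (A j j)).
Proof.
move=> tA; rewrite /spectral_radius /maxf.
have eigA z : eigenvalue A z = (z \in [seq A j j | j <- index_enum 'I_d]).
  rewrite eigenvalue_root_char -root_prod_XsubC big_map.
  case: tA => tA; first by rewrite char_poly_trig.
  rewrite -char_poly_tr char_poly_trig//; congr (root _ _).
  by apply: eq_bigr => j _; rewrite mxE.
congr sup; apply/seteqP; split=> [_ [z /= + <-]|_ [j _ <-]].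
  by rewrite eigA => /mapP[j _ ->]; exists j.
exists (A j j) => //=; rewrite eigA; apply/mapP; exists j => //.
exact: mem_index_enum.
Qed.

Lemma mulmx_trig d (A B : 'M[C]_d) : is_trig_mx A -> is_trig_mx B ->
  is_trig_mx (A *m B) /\ forall j, (A *m B) j j = A j j * B j j.
Proof.
move=> /is_trig_mxP tA /is_trig_mxP tB; split.
  apply/is_trig_mxP => i j ij; rewrite mxE big1// => k _.
  have [ik|ki] := ltnP i k; first by rewrite tA ?mul0r.
  by rewrite tB ?mulr0// (leq_ltn_trans ki).
move=> j; rewrite mxE (bigD1 j)//= big1 ?addr0// => k kj.
have [jk|] := ltnP j k; first by rewrite tA ?mul0r.
by rewrite leq_eqVlt (inj_eq val_inj) (negbTE kj)/= => kj'; rewrite tB ?mulr0.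
Qed.

Context (m d : nat) (T : 'I_m -> 'M[C]_d).
Hypothesis T_triangular :
  (forall i, is_trig_mx (T i)^T) \/ (forall i, is_trig_mx (T i)).

Definition word_product (s : seq 'I_m) : 'M[C]_d :=
  foldl (fun A i => T i *m A) 1%:M s.

Lemma mxprodE (s : nat -> 'I_m) n : mxprod T s n = word_product (mkseq s n).
Proof. by elim: n => //= n ->; rewrite mkseqS /word_product foldl_rcons. Qed.

Lemma word_product_trig s :
  (is_trig_mx (word_product s) \/ is_trig_mx (word_product s)^T) /\
  forall j, word_product s j j = \prod_(i <- s) T i j j.
Proof.
(* The disjunction in the goal could switch sides during the induction, so the side is fixed once
   for all words by the truth value of one alternative. *)
suff [tP PE] : (if `[< forall i, is_trig_mx (T i) >] then is_trig_mx (word_product s)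
    else is_trig_mx (word_product s)^T) /\
    forall j, word_product s j j = \prod_(i <- s) T i j j.
  by split=> //; move: tP; case: ifP => _; [left|right].
elim/last_ind: s => [|s i [IHt IHd]].
  split; last by move=> j; rewrite big_nil /word_product/= mxE eqxx.
  by rewrite /word_product/= trmx1; case: ifP => _; exact: scalar_mx_is_trig.
rewrite /word_product foldl_rcons -/(word_product s).
case: (asboolP (forall i, is_trig_mx (T i))) IHt => [tT|ntT] tP.
  have [tM dM] := mulmx_trig (tT i) tP; split=> // j.
  by rewrite dM IHd -cats1 big_cat big_seq1 mulrC.
have tT k : is_trig_mx (T k)^T by case: T_triangular.
rewrite trmx_mul; have [tM dM] := mulmx_trig tP (tT i); split=> // j.
have -> : (T i *m word_product s) j j = ((word_product s)^T *m (T i)^T) j j.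
  by rewrite -trmx_mul [RHS]mxE.
by rewrite dM !mxE IHd -cats1 big_cat big_seq1.
Qed.

Hypothesis T_diag : forall i j, T i j j != 0.

Lemma cmod_gt0 (z : C) : z != 0 -> 0 < cmod z.
Proof.
move=> z0; rewrite lt_neqAle eq_sym; apply/andP; split.
  by apply: contra z0 => /eqP /ComplexField.Normc.eq0_normc ->.
by rewrite /cmod; case: (z) => a b; exact: sqrtr_ge0.
Qed.

Lemma cmod_prod (s : seq 'I_m) (j : 'I_d) :
  0 < cmod (\prod_(i <- s) T i j j) /\
  ln (cmod (\prod_(i <- s) T i j j)) = \sum_(i <- s) ln (cmod (T i j j)).
Proof.
elim: s => [|i s [IH0 IHE]].
  rewrite !big_nil; have -> : cmod (1 : C) =
      1 by rewrite /cmod ComplexField.Normc.normc1.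
  by rewrite ln1.
have cmodM (x y : C) : cmod (x * y) = cmod x * cmod y := ComplexField.Normc.normcM x y.
have ci0 : 0 < cmod (T i j j) by exact: cmod_gt0.
by rewrite !big_cons cmodM mulr_gt0// lnM ?posrE// IHE.
Qed.

Definition word_rho (s : seq 'I_m) : R :=
  spectral_radius (word_product s) `^ (size s)%:R^-1.

Lemma rho_nE n (s : nat -> 'I_m) : rho_n T n s = word_rho (mkseq s n).
Proof. by rewrite /rho_n mxprodE /word_rho size_mkseq. Qed.

(** The logarithm turns a bound on a maximum of products into simultaneous bounds on sums; [j0]
    guarantees that [maxf] is attained. *)
Lemma word_rho_lt (j0 : 'I_d) (s : seq 'I_m) (y : R) : (0 < size s)%N -> 0 < y ->
  (word_rho s < y) =
  [forall j : 'I_d, \sum_(i <- s) ln (cmod (T i j j)) < (size s)%:R * ln y].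
Proof.
move=> s0 y0; have [tP PE] := word_product_trig s.
have -> : word_rho s = (maxf (fun j => cmod (word_product s j j))) `^ (size s)%:R^-1.
  by rewrite /word_rho spectral_radius_trig.
set M := maxf _; have sR0 : 0 < (size s)%:R :> R by rewrite ltr0n.
have M0 : 0 < M.
  have [[k kE] _] := maxfP (fun j => cmod (word_product s j j)) j0.
  by rewrite /M -kE PE; case: (cmod_prod s k).
rewrite -ltr_ln ?posrE ?powR_gt0// ln_powR ltr_pdivrMl//.
rewrite -ltr_expR lnK ?posrE// (maxf_lt _ j0).
apply: eq_forallb => j; have [c0 cE] := cmod_prod s j.
by rewrite PE -cE -[RHS]ltr_expR lnK ?posrE.
Qed.

End spectral_radius_triangular.

(** * Continuity of the distribution function at a point without mass *)

Section atomless.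
Context (R : realType) (d : measure_display) (T : measurableType d)
  (P : probability T R) (Y : T -> R).
Hypothesis mY : measurable_fun setT Y.

(** The events that Y is within 1 / (n + 1) of x decrease to the null event Y = x, and their
    probabilities bound the variation of the distribution function near x. *)
Lemma atomless_continuous_lt (x : R) : P [set w | Y w = x] = 0%E ->
  {for x, continuous (fun y : R => P [set w | Y w < y])}.
Proof.
move=> Yx0.
pose E (n : nat) := [set w | `|Y w - x| <= n.+1%:R^-1].
have mE n : measurable (E n).
  have -> : E n = Y @^-1` `[x - n.+1%:R^-1, x + n.+1%:R^-1]%classic.
    by apply/seteqP; split=> w; rewrite /E/= in_itv/= -ler_distl.
  by rewrite -[X in measurable X]setTI; exact: (mY measurableT (measurable_itv _)).
have EI : \bigcap_n E n = [set w | Y w = x].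
  apply/seteqP; split=> [w Ew|w /= Yw n _]; last by rewrite /E/= Yw subrr normr0.
  apply/eqP; rewrite -subr_eq0 -normr_le0; apply/ler_addgt0Pr => e e0.
  rewrite add0r (le_trans (Ew (Num.bound e^-1) I))// -[leRHS]invrK lef_pV2 ?posrE
      ?invr_gt0//.
  rewrite (le_trans (ltW (archi_boundP _)))// ?invr_ge0 ?(ltW e0)//.
  by rewrite ler_nat.
have cvgE : (fine \o (P \o E)) n @[n --> \oo] --> 0.
  have : (P \o E) n @[n --> \oo] --> 0%:E.
    rewrite (_ : 0%:E = P (\bigcap_n E n)); last by rewrite EI.
    apply: nonincreasing_cvg_mu => //.
    - by rewrite (le_lt_trans (probability_le1 _ _))// ltry.
    - exact: bigcapT_measurable.
    - move=> n k nk; apply/subsetPset => w; rewrite /E/= => /le_trans; apply.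
      by rewrite lef_pV2 ?posrE// ler_nat.
  exact: fine_cvg.
have mlt y := measurable_fun_lt y mY.
have PE y : P [set w | Y w < y] = (fine (P [set w | Y w < y]))%:E.
  by rewrite fineK ?fin_num_measure.
rewrite /prop_for/continuous_at PE (_ : (fun y => _) = (fun y =>
    (fine (P [set w | Y w < y]))%:E)); last first.
  by apply/funext => y; rewrite -PE.
apply/cvg_EFin; first exact: nearW.
apply/cvgrPdist_le => e e0.
have /cvgrPdist_le/(_ _ e0)[N _ HN] := cvgE.
have {}HN : fine (P (E N)) <= e.
  have := HN N (leqnn N); rewrite /= sub0r normrN; apply: le_trans; exact: ler_norm.
have le_fine A B : measurable A -> measurable B -> A `<=` B -> fine (P A) <= fine (P B).
  by move=> mA mB AB; rewrite fine_le ?fin_num_measure// le_measure ?inE.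
have leU a b : a <= b -> x - N.+1%:R^-1 <= a -> b <= x + N.+1%:R^-1 ->
    `|fine (P [set w | Y w < a]) - fine (P [set w | Y w < b])| <= e.
  move=> ab xa bx; rewrite distrC ger0_norm; last first.
    by rewrite subr_ge0 le_fine// => w /= /lt_le_trans; apply.
  rewrite lerBlDr (le_trans _ (lerD HN (lexx _)))//.
  rewrite -fineD ?fin_num_measure// fine_le ?fin_numD ?fin_num_measure//.
  apply: (@le_trans _ _ (P (E N `|` [set w | Y w < a]))).
    rewrite le_measure ?inE//; first exact: measurableU.
    move=> w /= Yb; have [|aY] := ltP (Y w) a; [by right|left].
    rewrite /E/= ler_distl; apply/andP; split.
      exact: le_trans xa aY.
    exact: le_trans (ltW Yb) bx.
  exact: measureU2.
near=> y.
have : `|x - y| <= N.+1%:R^-1.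
  by near: y; apply: cvgr_dist_le => //; rewrite invr_gt0.
rewrite ler_distlC => /andP[y1 y2].
have [xy|yx] := leP x y; last rewrite distrC; apply: leU => //.
- by rewrite gerBl invr_ge0.
- exact: ltW.
- by rewrite lerDl invr_ge0.
Unshelve. all: by end_near. Qed.

End atomless.

(** * Transfer to the spectral radius *)

Lemma ler_nat_bool (R : numDomainType) (b1 b2 : bool) :
  (b1 -> b2) -> b1%:R <= b2%:R :> R.
Proof. by rewrite ler_nat; case: b1 b2 => [] [] // /(_ isT). Qed.

Lemma nbhs_infty_sqrtr_ge (R : realType) (Z : R) :
    \forall n \near \oo, Z <= Num.sqrt n%:R.
Proof.
near=> n; apply: (le_trans (ler_norm Z)).
rewrite -sqrtr_sqr ler_sqrt//.
by near: n; exact: nbhs_infty_ger.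
Unshelve. all: by end_near. Qed.

(** This is ln (1 + u) <= u at u = z / y - 1. Exchanging the two points yields the upper and the
    lower linearisation of the logarithm in [word_rho_levy]. *)
Lemma ln_sub_ge (R : realType) (y z : R) : 0 < y -> 0 < z -> (y - z) / y <= ln y - ln z.
Proof.
move=> y0 z0; rewrite -lerN2 opprB -ln_div ?posrE//.
have -> : - ((y - z) / y) = z / y - 1 by field; rewrite gt_eqF.
have := @le_ln1Dx R (z / y - 1) ltac:(by rewrite ltrBrDl subrr divr_gt0).
by rewrite addrC subrK.
Qed.

Lemma measurable_maxf (R : realType) (I : finType) (d : measure_display)
  (T : measurableType d) (f : I -> T -> R) (i0 : I) :
  (forall i, measurable_fun setT (f i)) ->
  measurable_fun setT (fun w => maxf (f ^~ w)).
Proof.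
move=> mf.
have -> : (fun w => maxf (f ^~ w)) = (fun w =>
    \big[Num.max/f i0 w]_(i <- enum I) f i w).
  apply/funext => w; have [[k kE] fle] := maxfP (f ^~ w) i0.
  rewrite big_enum/=; apply/le_anti/andP; split.
    by rewrite -kE; exact: (le_bigmax _ (fun i => f i w)).
  by apply/bigmax_leP; split=> [|i _]; exact: fle.
elim: (enum I) => [|i r IHr].
  by under eq_fun do rewrite big_nil; exact: mf.
by under eq_fun do rewrite big_cons; exact: measurable_maxr.
Qed.

Section triangular_clt.
Context (R : realType) (m d : nat) (T : 'I_m -> 'M[R[i]]_d).
Hypothesis T_triangular :
  (forall i, is_trig_mx (T i)^T) \/ (forall i, is_trig_mx (T i)).
Hypothesis T_diag : forall i j, T i j j != 0.
Variable p : 'I_m -> R.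
Hypothesis p_ge0 : forall i, 0 <= p i.
Hypothesis p_sum1 : \sum_(i < m) p i = 1.

Local Notation J := (argmax T p).
Local Notation rho := (rho_inf T p).

Definition centered_log (j : 'I_d) (i : 'I_m) : R :=
  ln (cmod (T i j j)) - mu_log T p j.

Lemma centered_log_mean j : \sum_(i < m) p i * centered_log j i = 0.
Proof.
under eq_bigr do rewrite mulrBr.
by rewrite sumrB -mulr_suml p_sum1 mul1r -mu_logE// subrr.
Qed.

Lemma SigmaE (l h : J) :
  Sigma l h = \sum_(i < m) p i * centered_log (val l) i * centered_log (val h) i.
Proof.
rewrite /Sigma /centered_log; set a := mu_log T p (val l); set b := mu_log T p (val h).
have E (i : 'I_m) : p i * (ln (cmod (T i (val l) (val l))) - a) * (ln (cmod (T i
    (val h) (val h))) - b) =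
    p i * ln (cmod (T i (val l) (val l))) * ln (cmod (T i (val h) (val h))) -
    (b * (p i * ln (cmod (T i (val l) (val l)))) +
    (a * (p i * ln (cmod (T i (val h) (val h)))) - a * b * p i)) by ring.
under [in RHS]eq_bigr do rewrite E.
rewrite sumrB big_split sumrB/= -!mulr_sumr p_sum1 -!mu_logE// -/a -/b; ring.
Qed.

Lemma rho_inf_at_gt0 j : 0 < rho_inf_at T p j.
Proof. by apply: prodr_gt0 => i _; rewrite powR_gt0 ?cmod_gt0. Qed.

Section nonempty.
Variable j0 : 'I_d.

Lemma rho_inf_gt0 : 0 < rho.
Proof. by rewrite /rho_inf; have [[j <-] _] := maxfP (rho_inf_at T p) j0;
    exact: rho_inf_at_gt0. Qed.

Lemma mu_log_argmax (j : J) : mu_log T p (val j) = ln rho.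
Proof. by rewrite /mu_log; congr ln; apply/eqP; exact: (valP j). Qed.

Lemma mu_log_le j : mu_log T p j <= ln rho.
Proof.
rewrite /mu_log ler_ln ?posrE ?rho_inf_at_gt0 ?rho_inf_gt0//.
by have [_] := maxfP (rho_inf_at T p) j0.
Qed.

Lemma mu_log_lt j : rho_inf_at T p j != rho -> mu_log T p j < ln rho.
Proof.
move=> jr; rewrite /mu_log ltr_ln ?posrE ?rho_inf_at_gt0 ?rho_inf_gt0//.
by rewrite lt_neqAle jr; have [_] := maxfP (rho_inf_at T p) j0; apply.
Qed.

(** Still exact: no index is discarded and the logarithm is not yet linearised. *)
Lemma scaled_word_rho_lt (s : seq 'I_m) (x : R) (q := Num.sqrt (size s)%:R) :
  (0 < size s)%N -> 0 < rho + x / q ->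
  (q * (word_rho T s - rho) < x) =
  [forall j : 'I_d, nsum centered_log j s < q * (ln (rho + x / q) - mu_log T p j)].
Proof.
move=> s0 y0; have q0 : 0 < q by rewrite sqrtr_gt0 ltr0n.
have q2 : q * q = (size s)%:R by rewrite -expr2 sqr_sqrtr.
rewrite mulrC -ltr_pdivlMr// ltrBlDl (word_rho_lt T_triangular T_diag j0)//.
apply: eq_forallb => j; rewrite /nsum -/q ltr_pdivrMr// mulrAC q2 /centered_log.
rewrite sumrB big_const_seq count_predT iter_addr_0 -[mu_log T p j *+ _]mulr_natl
    mulrBr.
by rewrite ltrD2r.
Qed.

Context (dG : measure_display) (OmegaG : measurableType dG)
  (PG : probability OmegaG R) (G : J -> {RV PG >-> R}).
Hypothesis G_gauss : centered_gaussian (@Sigma R m d T p) G.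

(** For j in J the threshold q (ln (rho + x / q) - ln rho) tends to x / rho; for other j the gap in
    the means pushes it up at rate q. The first inequality just forgets the indices outside J, the
    second has to pay for them. Half of [eps] is the shift of the central limit theorem, the other
    half absorbs the curvature of the logarithm. *)
Lemma word_rho_levy (x eps eta : R) : 0 < eps -> 0 < eta ->
  let Y w := rho * maxf (fun j => G j w) in
  \forall n \near \oo,
    path_mean p n (fun s => (Num.sqrt n%:R * (word_rho T s - rho) < x - eps)%R%:R) <=
      fine (PG [set w | Y w < x + eps]) + eta /\
    fine (PG [set w | Y w < x - eps]) <=
      path_mean p n (fun s => (Num.sqrt n%:R * (word_rho T s - rho) < x +
          eps)%R%:R) + eta.
Proof.
move=> eps0 eta0 Y; have rho0 := rho_inf_gt0.
have eta20 : 0 < eta / 2 by rewrite divr_gt0.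
pose c := x / rho; pose eps' := eps / 2 / rho.
have eps'0 : 0 < eps' by rewrite !divr_gt0.
have [i0] := argmax_inhabited T p (leq_ltn_trans (leq0n _) (ltn_ord j0)).
pose v (j : J) := centered_log (val j).
have v0 j : \sum_(i < m) p i * v j i = 0 by exact: centered_log_mean.
have clt := clt_forall_lt p_ge0 p_sum1 v0 SigmaE G_gauss c eps'0 eta20.
pose z := x + eps.
have cE : c + eps' = (z - eps / 2) / rho by rewrite /c /eps' /z; field; rewrite gt_eqF.
pose g j := ln rho - mu_log T p j.
have g0 j : 0 <= g j by rewrite subr_ge0 mu_log_le.
pose V j := \sum_(i < m) p i * centered_log j i * centered_log j i.
have V0 j : 0 <= V j.
  by apply: sumr_ge0 => i _; rewrite -mulrA mulr_ge0// -expr2 sqr_ge0.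
(* For j in J the gap [g j] is 0 and division by 0 gives 0, so the terms of [D], [Z] and later
   [tail] vanish there: these sums concern only the indices outside J. *)
pose D := \sum_(j : 'I_d) 4 * V j / g j ^+ 2.
pose Z := \sum_(j : 'I_d) 2 * `|c + eps'| / g j.
near=> n.
have n0 : (0 < n)%N by near: n; exists 1%N.
pose q : R := Num.sqrt n%:R.
have q0 : 0 < q by rewrite sqrtr_gt0 ltr0n.
have q2 : q ^+ 2 = n%:R by rewrite sqr_sqrtr.
have pos u : (`|u| + 1) / rho <= q -> 0 < rho + u / q.
  rewrite ler_pdivrMr// => uq.
  have : - `|u| <= u by rewrite lerNl -normrN ler_norm.
  move=> nu; rewrite -(mulfK (lt0r_neq0 q0) rho) -mulrDl divr_gt0//; lra.
have y1 : 0 < rho + (x - eps) / q by apply: pos; rewrite /q; near: n;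
    exact: nbhs_infty_sqrtr_ge.
have y2 : 0 < rho + z / q by apply: pos; rewrite /q; near: n;
    exact: nbhs_infty_sqrtr_ge.
have qz : `|(z - eps / 2) * z| / (rho * (eps / 2)) <= q by rewrite /q; near: n;
    exact: nbhs_infty_sqrtr_ge.
have qZ : Z <= q by rewrite /q; near: n; exact: nbhs_infty_sqrtr_ge.
have qD : D / (eta / 2) <= n%:R by near: n; exact: nbhs_infty_ger.
have [clt1 clt2] : path_mean p n (fun s => [forall j, nsum v j s < c - eps']%:R) <=
      fine (PG [set w | [forall j, G j w < c + eps']]) + eta / 2 /\
    fine (PG [set w | [forall j, G j w < c - eps']]) <=
      path_mean p n (fun s => [forall j, nsum v j s < c + eps']%:R) + eta / 2.
  by near: n; exact: clt.
have mY : measurable_fun setT Y by apply: measurable_funM => //; exact: measurable_maxf.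
have mG u := measurable_gaussian_below G u.
split.
  apply: (@le_trans _ _ (path_mean p n (fun s =>
      [forall j, nsum v j s < c - eps']%:R))).
    apply: le_path_mean => // s sn.
    rewrite -sn scaled_word_rho_lt ?sn//.
    apply: ler_nat_bool => /forallP xs; apply/forallP => j.
    have := xs (val j); rewrite mu_log_argmax => /lt_le_trans; apply.
    have h := @ln_sub_ge R rho (rho + (x - eps) / q) rho0 y1.
    have : q * (ln (rho + (x - eps) / q) - ln rho) <= (x - eps) / rho.
      rewrite -ler_pdivlMl// mulrA; lra.
    rewrite -/q => /le_trans; apply.
    rewrite /c /eps' -mulrBl ler_pM2r ?invr_gt0//; lra.
  rewrite (le_trans clt1)// lerD//; last lra.
  rewrite fine_le ?fin_num_measure//; first exact: measurable_fun_lt.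
  rewrite le_measure ?inE//; first exact: measurable_fun_lt.
  move=> w /=; rewrite -(maxf_lt _ i0) => h.
  rewrite /Y mulrC -ltr_pdivlMr// (lt_le_trans h)//.
  rewrite /c /eps' -mulrDl ler_pM2r ?invr_gt0//; lra.
(* The lower linearisation gives z / (rho + z / q), which tends to z / rho; [qz] makes q large
   enough for it to exceed (z - eps / 2) / rho. *)
have qln : c + eps' <= q * (ln (rho + z / q) - ln rho).
  have := @ln_sub_ge R (rho + z / q) rho y2 rho0.
  rewrite addrC addKr => h.
  rewrite -ler_pdivrMl// (le_trans _ h)//.
  rewrite cE ler_pdivlMr//.
  have -> : q^-1 * ((z - eps / 2) / rho) * (rho + z / q) =
      (z - eps / 2 + (z - eps / 2) * z / (rho * q)) / q.
    by field; rewrite !gt_eqF.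
  rewrite ler_pM2r ?invr_gt0//.
  suff : (z - eps / 2) * z / (rho * q) <= eps / 2 by lra.
  rewrite ler_pdivrMr ?mulr_gt0// (le_trans (ler_norm _))//.
  have -> : eps / 2 * (rho * q) = q * (rho * (eps / 2)) by ring.
  by rewrite -ler_pdivrMr// mulr_gt0// divr_gt0.
apply: (@le_trans _ _ (path_mean p n (fun s =>
    [forall j, nsum v j s < c + eps']%:R) + eta / 2)).
  apply: le_trans clt2.
  rewrite fine_le ?fin_num_measure//; first exact: measurable_fun_lt.
  rewrite le_measure ?inE//; first exact: measurable_fun_lt.
  move=> w /=; rewrite -(maxf_lt _ i0) /Y mulrC -ltr_pdivlMr// => /lt_le_trans; apply.
  rewrite /c /eps' -mulrBl ler_pM2r ?invr_gt0//; lra.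
rewrite [X in _ <= _ + X](splitr eta) addrA lerD2r.
pose tail (s : seq 'I_m) := \sum_(j : 'I_d) (4 / (n%:R * g j ^+ 2)) * (nsum
    centered_log j s - 0) ^+ 2.
apply: (@le_trans _ _ (path_mean p n (fun s =>
    (Num.sqrt n%:R * (word_rho T s - rho) < x + eps)%R%:R + tail s))).
  apply: le_path_mean => // s sn.
  have tail0 : 0 <= tail s.
    apply: sumr_ge0 => j _; rewrite mulr_ge0 ?sqr_ge0// divr_ge0//.
    by rewrite mulr_ge0 ?sqr_ge0.
  case: (boolP (_ < _)) => [_|nlt].
    by rewrite -[leLHS]addr0 lerD// lern1 leq_b1.
  rewrite add0r; case: (boolP [forall _, _]) => [/forallP xs|//].
  move: nlt; rewrite -sn scaled_word_rho_lt ?sn// negb_forall => /existsP[j].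
  rewrite -leNgt -/q -/z => qj.
  have [jJ|jJ] := boolP (rho_inf_at T p j == rho).
    have := xs (exist _ j jJ); rewrite ltNge /nsum/= /v/= => /negP[].
    rewrite (le_trans qln)//; apply: le_trans qj.
    by rewrite -(mu_log_argmax (exist _ j jJ)).
  have gj : 0 < g j by rewrite subr_gt0 mu_log_lt.
  rewrite /tail (bigD1 j)//= -[true%:R]addr0 lerD//; last first.
    apply: sumr_ge0 => i _; rewrite mulr_ge0 ?sqr_ge0// divr_ge0//.
    by rewrite mulr_ge0 ?sqr_ge0.
  (* By [qZ], half of the gap q g j outweighs a negative c + eps'. The other half is a deviation
     whose square is at least n (g j)^2 / 4, whence the factor 4 in [tail]. *)
  have h : q * g j / 2 <= nsum centered_log j s.
    apply: le_trans qj.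
    have -> : ln (rho + z / q) - mu_log T p j = (ln (rho + z / q) - ln rho) + g j.
      by rewrite /g; ring.
    rewrite [leRHS]mulrDr.
    have : 2 * `|c + eps'| / g j <= q.
      rewrite (le_trans _ qZ)// /Z (bigD1 j)//= lerDl sumr_ge0// => i _.
      by rewrite divr_ge0// mulr_ge0.
    rewrite ler_pdivrMr// => h1.
    have h2 : - `|c + eps'| <= c + eps' by rewrite lerNl -normrN ler_norm.
    lra.
  rewrite subr0 -q2 mulrAC ler_pdivlMr ?mulr_gt0 ?exprn_gt0// mul1r.
  have -> : q ^+ 2 * g j ^+ 2 = 4 * (q * g j / 2) ^+ 2 by field.
  rewrite ler_pM2l// ler_sqr ?nnegrE//.
    by rewrite divr_ge0// mulr_ge0// ltW.
  by rewrite (le_trans _ h)// divr_ge0// mulr_ge0// ltW.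
rewrite path_meanD lerD2l path_mean_sum//.
under eq_bigr => j _.
  rewrite path_meanZ (@path_mean_nsum_sqr _ _ _ _ centered_log (fun l h =>
    \sum_(i < m) p i * centered_log l i * centered_log h i))//;
        last exact: centered_log_mean.
  rewrite expr0n/= addr0 -/(V j) (_ : _ * V j = n%:R^-1 * (4 * V j / g j ^+ 2));
      last first.
    by rewrite invfM; ring.
  over.
rewrite -mulr_sumr -/D mulrC ler_pdivrMr ?ltr0n//.
by rewrite mulrC -ler_pdivrMr.
Unshelve. all: by end_near. Qed.

End nonempty.

End triangular_clt.

Theorem theorem4 (R : realType) (m d : nat) (d_gt0 : (0 < d)%N)
    (T : 'I_m -> 'M[R[i]]_d)
    (T_triangular :
      (forall i, is_trig_mx (T i)^T) \/ (forall i, is_trig_mx (T i)))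
    (T_diag : forall i j, T i j j != 0)
    (p : 'I_m -> R) (p_ge0 : forall i, 0 <= p i)
    (p_sum1 : \sum_(i < m) p i = 1)
    (dO : measure_display) (Omega : measurableType dO)
    (P : probability Omega R) (idx : nat -> Omega -> 'I_m)
    (idx_iid : iid_indices p P idx)
    (dG : measure_display) (OmegaG : measurableType dG)
    (PG : probability OmegaG R) (G : argmax T p -> {RV PG >-> R})
    (G_gaussian : centered_gaussian (@Sigma R m d T p) G) :
  let X (n : nat) (w : Omega) : R :=
    Num.sqrt n%:R * (rho_n T n (fun k => idx k w) - rho_inf T p) in
  let maxG (w : OmegaG) : R := maxf (fun j => G j w) in
  let Y (w : OmegaG) : R := rho_inf T p * maxG w in
  [/\ cvg_in_distribution P X PG Y,
      forall x : R,
        {for x, continuous (fun y : R => PG [set w | Y w < y])} ->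
        (fun n => P [set w | X n w < x]) @ \oo -->
          PG [set w | maxG w < x / rho_inf T p]
    & posdefinite (@Sigma R m d T p) ->
        (forall x : R, PG [set w | Y w = x] = 0%E) /\
        (forall x : R, (fun n => P [set w | X n w < x]) @ \oo -->
          PG [set w | maxG w < x / rho_inf T p])].
Proof.
move=> X maxG Y.
pose j0 := Ordinal d_gt0.
have [i0] := argmax_inhabited T p d_gt0.
have rho0 : 0 < rho_inf T p by exact: rho_inf_gt0 T_diag p j0.
have mmax : measurable_fun setT maxG by apply: measurable_maxf.
have mY : measurable_fun setT Y by exact: measurable_funM.
have XE n w : X n w = Num.sqrt n%:R * (word_rho T (word idx n w) - rho_inf T p).
  by rewrite /X rho_nE.
(* [X n] depends only on the first n indices, so the preimage of any set is an event about a
   word. *)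
have mX n : measurable_fun setT (X n).
  move=> _ A mA; rewrite setTI.
  have -> : X n @^-1` A = [set w | `[< A (Num.sqrt n%:R * (word_rho T (word idx n
      w) - rho_inf T p)) >]].
    by apply/seteqP; split=> w; rewrite /= XE => /asboolP.
  exact: (measurable_word idx_iid n (fun s =>
      `[< A (Num.sqrt n%:R * (word_rho T s - rho_inf T p)) >])).
have XltE n x : fine (P [set w | X n w < x]) =
    path_mean p n (fun s => (Num.sqrt n%:R * (word_rho T s - rho_inf T p) < x)%R%:R).
  pose B s := Num.sqrt n%:R * (word_rho T s - rho_inf T p) < x.
  have -> : [set w | X n w < x] = [set w | B (word idx n w)].
    by apply/seteqP; split=> w; rewrite /= XE.
  by rewrite (probability_word idx_iid).
have levy (x eps eta : R) : 0 < eps -> 0 < eta -> \forall n \near \oo,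
    fine (P [set w | X n w < x - eps]) <= fine (PG [set w | Y w < x + eps]) + eta /\
    fine (PG [set w | Y w < x - eps]) <= fine (P [set w | X n w < x + eps]) + eta.
  move=> eps0 eta0; near do rewrite !XltE.
  exact: (word_rho_levy T_triangular T_diag p_ge0 p_sum1 j0 G_gaussian).
have maxGE x : [set w | maxG w < x / rho_inf T p] = [set w | Y w < x].
  by apply/seteqP; split=> w /=; rewrite ltr_pdivlMr// mulrC.
split.
- exact: levy_cvg_in_distribution.
- by move=> x cx; rewrite maxGE; exact: levy_cvg_cdf.
move=> [_ Spos].
(* Positive definiteness tested on a unit vector. *)
have Sgt0 j : 0 < @Sigma R m d T p j j.
  have := Spos (fun i => (i == j)%:R) (ex_intro _ j _);
      rewrite eqxx oner_eq0 => /(_ isT).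
  rewrite (bigD1 j)//= [X in _ + X]big1 ?addr0 => [|l lj]; last first.
    by rewrite big1// => h _; rewrite (negbTE lj) !mul0r.
  rewrite (bigD1 j)//= big1 ?addr0 => [|l lj]; last by rewrite (negbTE lj) mulr0.
  by rewrite eqxx mul1r mulr1.
have Y0 x : PG [set w | Y w = x] = 0%E.
  (* The maximum is one of the components, so Y = x forces some G j = x / rho: the event lies in a
     finite union of null events. *)
  pose U := \big[setU/set0]_(j : argmax T p) [set w | G j w = x / rho_inf T p].
  have [mU U0] : measurable U /\ PG U = 0%E.
    rewrite /U; elim/big_ind: _ => [|A B [mA A0] [mB B0]|j _].
    - by split=> //; exact: measure0.
    - by split; [exact: measurableU|exact: null_set_setU].
    - split; last exact: (gaussian_vector_atomless G_gaussian _ (Sgt0 j)).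
      rewrite -[X in measurable X]setTI.
      exact: (measurable_funPT (G j) measurableT _ (measurable_set1 (x / rho_inf T p))).
  apply: (subset_measure0 _ mU _ U0) => [|w /= Yx].
    rewrite -[X in measurable X]setTI.
    exact: (mY measurableT _ (measurable_set1 x)).
  have [[j jE] _] := maxfP (fun j => G j w) i0.
  rewrite /U (bigD1 j)//=; left => /=.
  by rewrite jE -Yx /Y /maxG [_ * maxf _]mulrC mulfK ?gt_eqF.
split=> // x; rewrite maxGE; apply: levy_cvg_cdf => //.
exact: atomless_continuous_lt.
Unshelve. all: by end_near. Qed.
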